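(* Suppose $\Omega \subset \mathbb{C}^n$ is a domain satisfying Condition $D$. Let $r \in \{1,\ldots,n\}$ and $A=(a_{jk}) \in M_{n\times r}(\mathbb{Z})$, and for each $\alpha,\beta\in\mathbb{N}^n$ define $g_{\alpha,\beta}:S^r\to\mathbb{C}$ by $$g_{\alpha,\beta}(\lambda_1,\ldots,\lambda_r)=\prod_{k=1}^r\lambda_k^{\sum_{j=1}^n a_{jk}(\alpha_j-\beta_j)}.$$ Suppose that, for all $\alpha,\beta\in\mathbb{N}^n$, $g_{\alpha,\beta}$ is identically equal to $1$ on $S^r$ when $\langle z^{\alpha},z^{\beta}\rangle\neq 0$. Then $\operatorname{int}(\overline{\Omega})$, the interior of the closure of $\Omega$, is $\rho_A$-invariant.
   Context: $\mathbb{N}$ denotes the natural numbers including $0$. For $\alpha=(\alpha_1,\ldots,\alpha_n)\in\mathbb{N}^n$, $z^{\alpha}=z_1^{\alpha_1}\cdots z_n^{\alpha_n}$. A domain is a nonempty connected open set. $dv$ is Lebesgue volume measure on $\mathbb{C}^n=\mathbb{R}^{2n}$. $S=\{\zeta\in\mathbb{C}:|\zeta|=1\}$. $M_{n\times r}(\mathbb{Z})$ is the set of $n\times r$ integer matrices. $A^2(\Omega)$ is the Bergman space of holomorphic functions on $\Omega$ that are square-integrable with respect to $dv$, with inner product $\langle f,g\rangle=\int_\Omega f\bar g\,dv$. $\|\cdot\|_{L^2(\Omega)}$ is the $L^2$-norm on $\Omega$ with respect to $dv$. Condition $D$: let $\Omega\subset\mathbb{C}^n$ be a domain such that $z^\alpha\in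 A^2(\Omega)$ for all $\alpha\in\mathbb{N}^n$. For $j\in\{1,\ldots,n\}$, $\Omega$ satisfies Condition $D_j$ if $\sum_{k=1}^\infty \|z_j^k\|_{L^2(\Omega)}^{-1/k}=\infty$. $\Omega$ satisfies Condition $D$ if it satisfies Condition $D_j$ for all $j=1,\ldots,n$. For $A=(a_{jk})\in M_{n\times r}(\mathbb{Z})$ and $\lambda=(\lambda_1,\ldots,\lambda_r)\in S^r$, the group action $\rho_A$ of the $r$-dimensional torus on $\mathbb{C}^n$ is $$\rho_A(\lambda)z=(\lambda_1^{a_{11}}\lambda_2^{a_{12}}\cdots\lambda_r^{a_{1r}}z_1,\ldots,\lambda_1^{a_{n1}}\cdots\lambda_r^{a_{nr}}z_n),\quad z\in\mathbb{C}^n.$$ A domain $U\subset\mathbb{C}^n$ is $\rho_A$-invariant if $\rho_A(\lambda)U:=\{\rho_A(\lambda)z: z\in U\}=U$ for every $\lambda\in S^r$. *)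

(* Defs.v *)
From HB Require Import structures.
From mathcomp Require Import all_boot all_order all_algebra.
From mathcomp Require Import complex.
From mathcomp Require Import all_classical all_reals all_analysis.

Set Implicit Arguments.
Unset Strict Implicit.
Unset Printing Implicit Defensive.

Import Order.TTheory GRing.Theory Num.Theory.
Import numFieldNormedType.Exports.

Local Open Scope classical_set_scope.
Local Open Scope ring_scope.
Local Open Scope complex_scope.

(* C = R[i] with the topology of its modulus, as a normed space over itself;
   'rV[R[i]]_n then carries the usual topology of C^n (sup norm), and
   `differentiable` on it is complex (Frechet) differentiability. *)
#[warnings="-redundant-canonical-projection"]
HB.instance Definition _ (R : realType) := NormedModule.copy R[i] R[i]^o.

(* An alias of m1 \x m2 on which the sigma-finite structure is inferable: on
   product_measure1 itself the library's later, more specific instances for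
   subprobabilities shadow it. *)
Section sigma_finite_product.
Context d1 d2 (T1 : measurableType d1) (T2 : measurableType d2) (R : realType).
Variable m1 : {sigma_finite_measure set T1 -> \bar R}.
Variable m2 : {sigma_finite_measure set T2 -> \bar R}.

Definition sigma_finite_product : set (T1 * T2) -> \bar R := (m1 \x m2)%E.

HB.instance Definition _ := Measure.copy sigma_finite_product (m1 \x m2)%E.

Let sigma_finite_product_sigma_finite : sigma_finite setT sigma_finite_product.
Proof.
have /sigma_finiteP[F [TF ndF Foo]] := sigma_finiteT m1.
have /sigma_finiteP[G [TG ndG Goo]] := sigma_finiteT m2.
exists (fun n => F n `*` G n).
  rewrite -setXTT TF TG predeqE => -[x y]; split.
    move=> [/= [n _ Fnx] [k _ Gky]]; exists (maxn n k) => //; split.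
    - by move: x Fnx; exact/subsetPset/ndF/leq_maxl.
    - by move: y Gky; exact/subsetPset/ndG/leq_maxr.
  by move=> [n _ []/= ? ?]; split; exists n.
move=> k; have [? ?] := Foo k; have [? ?] := Goo k.
split; first exact: measurableX.
by rewrite /sigma_finite_product product_measure1E// lte_mul_pinfty//
  ge0_fin_numE.
Qed.

HB.instance Definition _ := Measure_isSigmaFinite.Build _ _ _
  sigma_finite_product sigma_finite_product_sigma_finite.

End sigma_finite_product.

Section cons_measure.
Context d (T : measurableType d) (R : realType) (n : nat).
Variable m1 : {sigma_finite_measure set T -> \bar R}.
Variable m2 : {sigma_finite_measure set (n.-tuple T) -> \bar R}.

Let tcons (p : T * n.-tuple T) : n.+1.-tuple T := [the _.-tuple _ of p.1 :: p.2].

Let measurable_tcons : measurable_fun [set: T * n.-tuple T] tcons.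
Proof. exact: measurable_cons. Qed.

(* The product measure m1 \x m2, transported along T x T^n = T^(n+1). *)
Definition cons_measure : set (n.+1.-tuple T) -> \bar R :=
  pushforward (sigma_finite_product m1 m2) tcons.

Let cons_measure0 : cons_measure set0 = 0%E.
Proof. by rewrite /cons_measure /pushforward preimage_set0 measure0. Qed.

Let cons_measure_ge0 A : (0 <= cons_measure A)%E.
Proof. exact: measure_ge0. Qed.

Let cons_measure_sigma_additive : semi_sigma_additive cons_measure.
Proof.
exact: (@measure_semi_sigma_additive _ _ _
  (measure_function_pushforward__canonical__measure_function_Measure
     (sigma_finite_product m1 m2) measurable_tcons)).
Qed.

HB.instance Definition _ := isMeasure.Build _ _ _ cons_measure
  cons_measure0 cons_measure_ge0 cons_measure_sigma_additive.

Let tuncons (t : n.+1.-tuple T) : T * n.-tuple T :=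
  (thead t, [the _.-tuple _ of behead t]).

Let tconsK : cancel tcons tuncons.
Proof. by move=> [x t]; congr pair; apply/val_inj. Qed.

Let measurable_tuncons : measurable_fun setT tuncons.
Proof.
apply/measurable_fun_pair.
  exact: (@measurable_tnth _ T n.+1 ord0).
exact: measurable_behead.
Qed.

Let cons_measure_sigma_finite : sigma_finite setT cons_measure.
Proof.
have [F TF mF] := sigma_finiteT (sigma_finite_product m1 m2).
exists (fun k => tuncons @^-1` F k).
  by rewrite -preimage_bigcup -TF preimage_setT.
move=> k; have [mFk Fkoo] := mF k; split.
  by rewrite -[X in measurable X]setTI; exact: measurable_tuncons.
rewrite /cons_measure /pushforward -comp_preimage.
by rewrite (_ : tuncons \o tcons = id) //; apply/funext => p; exact: tconsK.
Qed.

HB.instance Definition _ := Measure_isSigmaFinite.Build _ _ _ cons_measure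
  cons_measure_sigma_finite.

End cons_measure.

(* The n-fold product measure m x ... x m on T^n. *)
Fixpoint power_measure d (T : measurableType d) (R : realType)
    (m : {sigma_finite_measure set T -> \bar R}) (n : nat) :
    {sigma_finite_measure set (n.-tuple T) -> \bar R} :=
  match n with
  | 0 => \d_([tuple] : 0.-tuple T)
  | n'.+1 => cons_measure m (power_measure m n')
  end.

Section bergman.
Context {R : realType}.

(* dv, on R^(2n) presented as (R x R)^n. *)
Definition volume (n : nat) :
    {sigma_finite_measure set (n.-tuple (measurableTypeR R * measurableTypeR R))
       -> \bar R} :=
  power_measure (sigma_finite_product lebesgue_measure lebesgue_measure) n.

(* The identification R^(2n) = C^n. *)
Definition toCn (n : nat)
    (t : n.-tuple (measurableTypeR R * measurableTypeR R)) : 'rV[R[i]]_n :=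
  \row_(j < n) ((tnth t j).1 +i* (tnth t j).2).

Definition integralCn (n : nat) (Omega : set 'rV[R[i]]_n)
    (F : 'rV[R[i]]_n -> R[i]) : R[i] :=
  (\int[volume n]_(t in @toCn n @^-1` Omega) complex.Re (F (toCn t))) +i*
  (\int[volume n]_(t in @toCn n @^-1` Omega) complex.Im (F (toCn t))).

Definition inner (n : nat) (Omega : set 'rV[R[i]]_n)
    (f g : 'rV[R[i]]_n -> R[i]) : R[i] :=
  integralCn Omega (fun z => f z * (g z)^*).

Definition L2norm (n : nat) (Omega : set 'rV[R[i]]_n)
    (f : 'rV[R[i]]_n -> R[i]) : \bar R :=
  'N[volume n]_2%:E[EFin \o
    ((fun t => ComplexField.Normc.normc (f (toCn t))) \_ (@toCn n @^-1` Omega))]%E.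

(* Meant for open Omega: a holomorphic f is then continuous on Omega, so no
   separate measurability requirement is needed. *)
Definition bergman_space (n : nat) (Omega : set 'rV[R[i]]_n) :
    set ('rV[R[i]]_n -> R[i]) :=
  [set f | (forall z, Omega z -> differentiable f z) /\
           (L2norm Omega f < +oo)%E].

Definition domain (n : nat) (Omega : set 'rV[R[i]]_n) : Prop :=
  [/\ open Omega, connected Omega & Omega !=set0].

Definition monomial (n : nat) (alpha : 'I_n -> nat) (z : 'rV[R[i]]_n) : R[i] :=
  \prod_(j < n) z 0 j ^+ alpha j.

(* Only used when the norms involved are finite, so that `fine` is harmless. *)
Definition condition_Dj (n : nat) (Omega : set 'rV[R[i]]_n) (j : 'I_n) : Prop :=
  (\sum_(1 <= k <oo)
     (fine (L2norm Omega (fun z => z 0%R j ^+ k)) `^ (- k%:R^-1))%:E = +oo)%E.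

Definition condition_D (n : nat) (Omega : set 'rV[R[i]]_n) : Prop :=
  [/\ domain Omega,
      forall alpha : 'I_n -> nat, bergman_space Omega (monomial alpha) &
      forall j : 'I_n, condition_Dj Omega j].

Definition torus (r : nat) : set 'rV[R[i]]_r :=
  [set lambda | forall k, `|lambda 0 k| = 1].

Definition rho (n r : nat) (A : 'M[int]_(n, r)) (lambda : 'rV[R[i]]_r)
    (z : 'rV[R[i]]_n) : 'rV[R[i]]_n :=
  \row_(j < n) ((\prod_(k < r) lambda 0 k ^ A j k) * z 0 j).

Definition rho_invariant (n r : nat) (A : 'M[int]_(n, r))
    (U : set 'rV[R[i]]_n) : Prop :=
  forall lambda, torus lambda -> rho A lambda @` U = U.

Definition gchar (n r : nat) (A : 'M[int]_(n, r)) (alpha beta : 'I_n -> nat)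
    (lambda : 'rV[R[i]]_r) : R[i] :=
  \prod_(k < r)
    lambda 0 k ^ (\sum_(j < n) A j k * ((alpha j)%:Z - (beta j)%:Z)).

End bergman.

(* Main.v *)
(** The character hypothesis says that all moments int_Omega z^alpha conj(z)^beta
    are unchanged when z is replaced by rho(lambda) z, so the real coordinates X
    of z and Y of rho(lambda) z have the same mixed moments on Omega. Condition D
    is Carleman's condition for these moments, hence X and Y have the same law,
    and it suffices to test this on Gaussians: multiplying a test function by
    cos(t X_i + b) preserves equality of the mixed moments, because the
    difference is, as a function of t, flat at 0 and quasi-analytic
    (Denjoy-Carleman, by Bang's elementary argument); and
    cos(y / 2^j)^(4^j) -> exp(- y^2 / 2).
    If z0 is in Omega but a = rho(lambda) z0 is not in its closure, a narrow
    Gaussian centred at a has a much larger integral over Omega along Y than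
    along X: a contradiction. So rho(lambda) maps Omega into its closure, for
    every lambda, and the interior of the closure is invariant. *)
Require Import Defs.
From mathcomp Require Import all_boot all_order all_algebra.
From mathcomp Require Import complex.
From mathcomp Require Import all_classical all_reals all_analysis.
From mathcomp Require Import measurable_realfun ring lra.

Import Order.TTheory GRing.Theory Num.Theory.
Import numFieldNormedType.Exports.

Set Implicit Arguments.
Unset Strict Implicit.
Unset Printing Implicit Defensive.

Local Open Scope classical_set_scope.
Local Open Scope ring_scope.

(** As [Omega] may be unbounded, equal moments alone need not give equal laws; this is why a
    quasi-analytic class enters. Condition D is used in the form in which it speaks, that of L2
    norms: for a coordinate [Z] and a fixed monomial [p], Cauchy-Schwarz bounds the integral of
    [|Z ^+ k * p|] by a constant times [M k], the norm of [z_j ^+ k]. Both laws share this [M],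
    because a rotation keeps [|z_j|]. Bang's argument consumes the divergence of the sum of the
    ratios [M k / M k.+1], while Condition D is about the roots of [M k]; Carleman's inequality
    converts one into the other. Only one real coordinate is treated at a time. All mixed monomials
    are carried along as test factors, so that each multiplication by a cosine ends in an equality
    of all mixed moments, ready for the next one. Gaussians are nonnegative products of one-variable
    functions, hence within reach of this iteration. Equal integrals see sets only up to volume
    zero, which is why the closure of [Omega] appears in the conclusion. *)

Section cos_taylor.
Context {R : realType}.
Implicit Types u v : R.

Lemma derive_ge0_ge0 (g dg : R -> R) (v : R) :
  (forall x : R, is_derive x 1 g (dg x)) -> (forall x, 0 <= x -> 0 <= dg x) ->
  g 0 = 0 -> 0 <= v -> 0 <= g v.
Proof.
move=> gd dg0 g0 v0.
have [|c] := @MVT_segment R g dg 0 v v0 (fun x _ => gd x).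
  apply: continuous_subspaceT => x.
  by apply/differentiable_continuous/derivable1_diffP; have [] := gd x.
rewrite in_itv/= => /andP[c0 _]; rewrite g0 !subr0 => ->.
by rewrite mulr_ge0// dg0.
Qed.

(** The Taylor polynomial of [v |-> cos (u + v)] at 0, of degree less than [m]. Writing the [i]-th
    derivative of the cosine as a phase shift by [i] quarter turns avoids a case split between sine
    and cosine. *)
Definition cos_poly (m : nat) u v : R :=
  \sum_(i < m) v ^+ i / i`!%:R * cos (u + i%:R * (pi / 2)).

Let is_derive_monomial (m : nat) (x : R) :
  is_derive x 1 (fun v => v ^+ m.+1 / m.+1`!%:R) (x ^+ m / m`!%:R).
Proof.
have -> : (fun v : R => v ^+ m.+1 / m.+1`!%:R) =
    (m.+1`!%:R)^-1 *: (@id R ^+ m.+1).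
  apply/funext => v; rewrite (_ : (_ *: _) v = (m.+1`!%:R)^-1 * (@id R ^+ m.+1) v)//.
  by rewrite exprfctE mulrC.
apply: is_derive_eq.
rewrite (_ : _ *: _ = (m.+1`!%:R)^-1 * (m.+1%:R * x ^+ m * 1))//.
rewrite mulr1 factS natrM.
have f0 : m`!%:R != 0 :> R by rewrite pnatr_eq0 -lt0n fact_gt0.
have m0 : m.+1%:R != 0 :> R by rewrite pnatr_eq0.
rewrite -natr1 in m0 *; field; exact/andP.
Qed.

Lemma is_derive_cos_poly (m : nat) u (x : R) :
  is_derive x 1 (cos_poly m.+1 u) (cos_poly m (u + pi / 2) x).
Proof.
elim: m => [|m ih].
  rewrite (_ : cos_poly 1 u = cst (cos u)).
    by rewrite /cos_poly big_ord0; exact: is_derive_cst.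
  apply/funext => v; rewrite /cos_poly big_ord1 expr0 fact0 divr1 mul1r.
  by rewrite mul0r addr0.
have -> : cos_poly m.+2 u = cos_poly m.+1 u +
    cos (u + m.+1%:R * (pi / 2)) *: (fun v => v ^+ m.+1 / m.+1`!%:R).
  by apply/funext => v; rewrite /cos_poly big_ord_recr/= [X in _ + X]mulrC.
apply: (is_derive_eq (is_deriveD ih (is_deriveZ _ (is_derive_monomial m x)))).
rewrite /cos_poly [RHS]big_ord_recr/=; congr (_ + _).
rewrite -[LHS]/(_ * _) mulrC; congr (_ * cos _).
by rewrite -[in LHS]natr1; ring.
Qed.

(** Induction on [m] with [u] general: the derivative in [v] of the remainder of order [m.+1] is the
    remainder of order [m] at phase [u + pi / 2]. *)
Let cos_taylor_ge0 (m : nat) u v : 0 <= v ->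
  `|cos (u + v) - cos_poly m u v| <= v ^+ m / m`!%:R.
Proof.
elim: m u v => [|m ih] u v v0.
  by rewrite /cos_poly big_ord0 subr0 expr0 fact0 divr1 cos_max.
pose f v := cos (u + v) - cos_poly m.+1 u v.
pose df v := cos ((u + pi / 2) + v) - cos_poly m (u + pi / 2) v.
have fd (x : R) : is_derive x 1 f (df x).
  have d1 := is_derive_cos_poly m u x.
  have d2 : is_derive x 1 (fun v => cos (u + v)) (cos ((u + pi / 2) + x)).
    have := @is_derive1_comp _ (@cos R) (fun v => u + v) x _ 1
      (is_derive_cos (u + x)).
    have d : is_derive x 1 (fun v => u + v) 1.
      have -> : (fun v => u + v) = cst u + id by apply/funext.
      by apply: is_derive_eq; rewrite add0r.
    move=> /(_ d); rewrite mulr1 => d'.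
    by apply: is_derive_eq; rewrite addrAC cosDpihalf.
  exact: is_deriveB.
have f0 : f 0 = 0.
  rewrite /f addr0 /cos_poly big_ord_recl big1 => [|i _].
    by rewrite expr0 fact0 divr1 mul1r mul0r !addr0 subrr.
  by rewrite expr0n/= mul0r mul0r.
(* Taking [s] to be 1 and -1 gives the two inequalities behind the absolute value. *)
have bound (s : R) : `|s| = 1 ->
    0 <= v ^+ m.+1 / m.+1`!%:R + s * f v.
  move=> s1.
  apply: (@derive_ge0_ge0 (fun v => v ^+ m.+1 / m.+1`!%:R + s * f v)
    (fun v => v ^+ m / m`!%:R + s * df v)) => // [x|x x0|]; last first.
  - by rewrite f0 mulr0 addr0 expr0n/= mul0r.
  - have := ih (u + pi / 2) x x0; rewrite -/(df x) -[`|_|]mul1r -s1 -normrM.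
    by rewrite ler_norml => /andP[h _]; rewrite -lerBlDl sub0r.
  - have d1 := is_derive_monomial m x; have d2 := fd x.
    have -> : (fun v => v ^+ m.+1 / m.+1`!%:R + s * f v) =
       (fun v => v ^+ m.+1 / m.+1`!%:R) + s *: f by [].
    exact: is_deriveD d1 (is_deriveZ s d2).
have := bound 1 (normr1 _); have := bound (-1); rewrite normrN normr1 => /(_ erefl).
by rewrite mul1r mulN1r subr_ge0 ler_norml => -> /=; rewrite -lerBlDl sub0r => ->.
Qed.

Lemma cos_taylor (m : nat) u v :
  `|cos (u + v) - cos_poly m u v| <= `|v| ^+ m / m`!%:R.
Proof.
have [v0|v0] := leP 0 v; first by rewrite (ger0_norm v0) cos_taylor_ge0.
rewrite (ltr0_norm v0).
(* The cosine is even, and its Taylor polynomial is unchanged when both [u] and [v] change sign, so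
   negative [v] reduces to positive [v]. *)
suff -> : cos (u + v) - cos_poly m u v = cos (- u - v) - cos_poly m (- u) (- v).
  by apply: cos_taylor_ge0; rewrite oppr_ge0 ltW.
rewrite -opprD cosN; congr (_ - _); apply: eq_bigr => i _.
(* The sine half is there to make the induction close. *)
have h (j : nat) : cos (- u + j%:R * (pi / 2)) = (-1) ^+ j * cos (u + j%:R * (pi / 2))
   /\ sin (- u + j%:R * (pi / 2)) = - (-1) ^+ j * sin (u + j%:R * (pi / 2)).
  elim: j => [|j [ih1 ih2]].
    by rewrite mul0r !addr0 cosN sinN expr0 mul1r mulN1r.
  rewrite -natr1 mulrDl mul1r !addrA !cosDpihalf !sinDpihalf ih1 ih2 exprS.
  by split; ring.
rewrite (h i).1 [in RHS](exprNn v).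
have : ((-1) ^+ i * (-1) ^+ i = 1 :> R) by rewrite -exprMn mulrNN mulr1 expr1n.
move: ((-1) ^+ i) => s s1; rewrite -[LHS]mul1r -s1.
by rewrite -!mulrA; congr (_ * _); rewrite mulrCA; congr (_ * _); rewrite mulrCA.
Qed.

End cos_taylor.

(** * Quasi-analyticity *)

Section quasi_analyticity.
Context {R : realType}.
Implicit Types (M : nat -> R) (F : nat -> R -> R).

Definition log_convex M := forall k, M k.+1 ^+ 2 <= M k * M k.+2.

Definition sum_unbounded (u : nat -> R) :=
  forall K, exists n, K < \sum_(k < n) u k.

Lemma log_convex_ratio_le M : (forall k, 0 < M k) -> log_convex M ->
  forall i j, (i <= j)%N -> M i.+1 / M i <= M j.+1 / M j.
Proof.
move=> M0 lM i j; elim: j => [|j ih]; first by rewrite leqn0 => /eqP ->.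
rewrite leq_eqVlt => /predU1P[->//|/ih /le_trans]; apply.
by rewrite ler_pdivrMr// mulrAC ler_pdivlMr// -expr2 mulrC lM.
Qed.

(** Ratios increase, so up to index [p.+1] each is at most the last one. This turns the Taylor sum
    of a descent step into a geometric sum. *)
Lemma log_convex_growth M : (forall k, 0 < M k) -> log_convex M ->
  forall p k i, (k + i <= p.+1)%N -> M (k + i)%N <= M k * (M p.+1 / M p) ^+ i.
Proof.
move=> M0 lM p k; elim=> [|i ih] kip; first by rewrite addn0 mulr1.
rewrite addnS in kip *; rewrite exprSr mulrA.
have -> : M (k + i).+1 = M (k + i)%N * (M (k + i).+1 / M (k + i)%N).
  by rewrite mulrC divfK// gt_eqF.
have Mge0 j : 0 <= M j by exact: ltW.
by apply: ler_pM; rewrite ?divr_ge0// ?ih ?log_convex_ratio_le// ltnW.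
Qed.

Lemma geometric_sum_le2 (y : R) n : 0 <= y -> y <= 2^-1 ->
  \sum_(i < n) y ^+ i <= 2.
Proof.
move=> y0 y2; elim: n => [|n ih]; first by rewrite big_ord0.
rewrite big_ord_recl expr0.
under eq_bigr do rewrite exprS.
rewrite -mulr_sumr.
have : y * \sum_(i < n) y ^+ i <= 2^-1 * 2.
  by apply: ler_pM => //; apply: sumr_ge0 => i _; exact: exprn_ge0.
by rewrite mulVf// => h; rewrite -[leRHS]/(1 + 1) lerD2l.
Qed.

Lemma le_div_exp2_le0 (x y : R) : (forall j, x <= y / 2 ^+ j) -> x <= 0.
Proof.
move=> h; rewrite leNgt; apply/negP => x0.
have := upper_nthrootP (leqnn (Num.bound (y / x))).
have := h (Num.bound (y / x)); rewrite ler_pdivlMr ?exprn_gt0//.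
by rewrite ltr_pdivrMr// mulrC => /le_lt_trans /[apply]; rewrite ltxx.
Qed.

Variables (F : nat -> R -> R) (M : nat -> R) (C : R).
Hypothesis M_gt0 : forall k, 0 < M k.
Hypothesis M_log_convex : log_convex M.
Hypothesis F_bounded : forall k t, `|F k t| <= C * M k.
Hypothesis F_taylor : forall k m t h,
  `|F k (t + h) - \sum_(i < m) h ^+ i / i`!%:R * F (k + i)%N t| <=
  C * (`|h| ^+ m / m`!%:R * M (k + m)%N).
Hypothesis F_flat : forall k, F k 0 = 0.
Hypothesis M_diverges : sum_unbounded (fun k => M k / M k.+1).

(* Bang's descent: moving by at most [M p / M p.+1 / 4] costs one level, these
   step sizes have infinite sum, and 0 lies in every level. *)
Let level (N : nat) (x : R) := forall k, `|F k x| <= C * (2 ^+ k * M k) / 2 ^+ N.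

Let C_ge0 : 0 <= C.
Proof. by rewrite -(pmulr_lge0 _ (M_gt0 0)) (le_trans _ (F_bounded 0 0)). Qed.

Let invfact_le1 i : (i`!%:R : R)^-1 <= 1.
Proof. by rewrite invf_le1 ?ltr0n ?fact_gt0// ler1n fact_gt0. Qed.

(** For [k >= p] the global bound on [F k] is enough. For [k < p], Taylor's formula at [x] gives
    terms of ratio [2 * q * |h|], the 2 coming from the weights [2 ^+ k] and [q] from the growth of
    [M]. The step size makes this ratio at most 1/2, so the sum is at most twice its first term, and
    this factor 2 is the level lost. *)
Let level_step (p : nat) (x h : R) :
  `|h| <= M p / M p.+1 / 4 -> level p.+1 x -> level p (x + h).
Proof.
move=> hh lx k.
have pow0 j : 0 < 2 ^+ j :> R by exact: exprn_gt0.
have [pk|kp] := leqP p k.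
  rewrite (le_trans (F_bounded _ _))// -mulrA ler_wpM2l// ler_pdivlMr//.
  by rewrite mulrC ler_pM2r// ler_eXn2l// ltr1n.
set q := M p.+1 / M p.
have q0 : 0 < q by rewrite divr_gt0.
have hq : `|h| * (2 * q) <= 2^-1.
  have : `|h| * q <= 4^-1.
    rewrite -ler_pdivlMr// /q invf_div mulrC; exact: hh.
  lra.
have bound i : (k + i <= p.+1)%N ->
    `|h| ^+ i / i`!%:R * (C * (2 ^+ (k + i) * M (k + i)%N) / 2 ^+ p.+1) <=
    C * (2 ^+ k * M k) / 2 ^+ p.+1 * (`|h| * (2 * q)) ^+ i.
  move=> kip; rewrite [leRHS](_ : _ =
      `|h| ^+ i * (C * (2 ^+ (k + i) * (M k * q ^+ i)) / 2 ^+ p.+1)).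
    apply: ler_pM.
    - by rewrite divr_ge0.
    - by rewrite !mulr_ge0 ?invr_ge0// ltW.
    - by rewrite ler_piMr ?exprn_ge0.
    - rewrite ler_pM2r ?invr_gt0// ler_wpM2l// ler_pM2l//.
      exact: log_convex_growth.
  by rewrite !exprMn exprD; ring.
(* At order [p.+1] the bound of level [p.+1] is the global bound, so the remainder fits in as the
   term [i = m] of the same geometric sum. *)
set m := (p.+1 - k)%N.
have km : (k + m = p.+1)%N by rewrite subnKC// ltnW// ltnS ltnW.
have -> : F k (x + h) = (F k (x + h) -
    \sum_(i < m) h ^+ i / i`!%:R * F (k + i)%N x) +
    \sum_(i < m) h ^+ i / i`!%:R * F (k + i)%N x by rewrite subrK.
apply: (@le_trans _ _ (\sum_(i < m.+1)
    C * (2 ^+ k * M k) / 2 ^+ p.+1 * (`|h| * (2 * q)) ^+ i)).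
  rewrite (le_trans (ler_normD _ _))// big_ord_recr/= addrC lerD//; last first.
    rewrite (le_trans (ler_norm_sum _ _ _))// ler_sum// => i _.
    have kip : (k + i <= p.+1)%N by rewrite -km leq_add2l ltnW.
    apply: le_trans (bound i kip).
    by rewrite !normrM normfV normrX (ger0_norm (ler0n _ _)) ler_wpM2l.
  apply: le_trans (bound m _); last by rewrite km.
  rewrite (le_trans (F_taylor _ _ _ _))// km mulrCA.
  by rewrite (mulrC (2 ^+ p.+1)) [C * (_ * 2 ^+ _)]mulrA mulfK// gt_eqF.
rewrite -mulr_sumr.
have sum2 : \sum_(i < m.+1) (`|h| * (2 * q)) ^+ i <= 2.
  by apply: geometric_sum_le2 => //; rewrite mulr_ge0// mulr_ge0// ltW.
rewrite (le_trans (ler_wpM2l _ sum2))//.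
  by rewrite !mulr_ge0 ?invr_ge0// ltW.
by rewrite exprSr invfM (mulrA _ _ 2^-1) divfK.
Qed.

Let level_reach m j (x : R) :
  `|x| <= \sum_(j <= k < j + m) M k / M k.+1 / 4 -> level j x.
Proof.
elim: m j x => [|m ih] j x.
  rewrite addn0 big_geq// normr_le0 => /eqP -> k.
  by rewrite F_flat normr0 !mulr_ge0 ?invr_ge0 ?exprn_ge0// ltW.
rewrite addnS big_ltn ?ltnS ?leq_addr// -addSn.
set S := \sum_(_ <= _ < _) _; set dl := M j / _ / _ => xS.
have S0 : 0 <= S by apply: sumr_ge0 => k _; rewrite !divr_ge0// ltW.
have d0 : 0 < dl by rewrite !divr_gt0.
have Sd : 0 < dl + S by rewrite ltr_wpDr.
(* Proportional splitting: the first summand is within reach of level [j.+1], the second is one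
   admissible step. *)
have -> : x = x * (S / (dl + S)) + x * (dl / (dl + S)).
  by rewrite -mulrDr -mulrDl addrC divff ?mulr1// gt_eqF.
have bd s : 0 <= s -> `|x * (s / (dl + S))| <= s.
  move=> s0; rewrite normrM (ger0_norm (divr_ge0 s0 (ltW Sd))) mulrCA.
  by rewrite ler_piMr// ler_pdivrMr// mul1r.
by apply: level_step; [exact: bd (ltW d0)|exact/ih/bd].
Qed.

(** [F k] stands for the [k]-th derivative of [F 0], but only Taylor estimates are asked of it. It
    is enough that [t] lies in every level, since at [k = 0] the bound of level [j] tends to 0. *)
Lemma bang_uniqueness t : F 0 t = 0.
Proof.
apply/eqP; rewrite -normr_le0; apply: (@le_div_exp2_le0 _ (C * M 0)) => j.
suff: level j t by move=> /(_ 0%N); rewrite expr0 mul1r.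
(* The steps usable towards level [j] start at index [j], so the first [j] terms are added to the
   target; the 4 clears the quarter in the step sizes. *)
have [n] := M_diverges (4 * `|t| + \sum_(k < j) M k / M k.+1).
move=> ltn; apply: (@level_reach n).
rewrite -mulr_suml ler_pdivlMr// mulrC -(lerD2r (\sum_(k < j) M k / M k.+1)).
rewrite (le_trans (ltW ltn))// -!(big_mkord xpredT (fun k => M k / M k.+1)).
rewrite addrC -big_cat_nat ?leq_addr//.
rewrite (big_cat_nat (leq0n n) (leq_addl j n))/= lerDl.
by apply: sumr_ge0 => k _; rewrite divr_ge0// ltW.
Qed.

End quasi_analyticity.

(** * Carleman's inequality *)

Section carleman.
Context {R : realType}.
Implicit Types (a M : nat -> R).

(* The weights [c_i] of Carleman's inequality: [c_0 ... c_(k-1) = (k+1)^k] and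
   [c_i / (i+1) = (1 + 1/(i+1))^(i+1) <= e]. *)
Let c (i : nat) : R := i.+2%:R ^+ i.+1 / i.+1%:R ^+ i.

Let c_gt0 i : 0 < c i.
Proof. by rewrite divr_gt0// exprn_gt0// ltr0n. Qed.

Let prod_c k : \prod_(i < k) c i = k.+1%:R ^+ k.
Proof.
elim: k => [|k ih]; first by rewrite big_ord0 expr0.
rewrite big_ord_recr/= ih /c mulrC divfK// expf_neq0//.
Qed.

Let c_le i : c i / i.+1%:R <= expR 1.
Proof.
rewrite /c -mulrA -invfM -exprSr -expr_div_n.
apply: (@le_trans _ _ (expR (i.+1%:R^-1) ^+ i.+1)).
  rewrite lerXn2r ?nnegrE ?divr_ge0 ?expR_ge0//.
  rewrite -natr1 mulrDl divff ?pnatr_eq0// mul1r; exact: expR_ge1Dx.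
by rewrite -expRM_natl mulfV// pnatr_eq0.
Qed.

Let S a n := \sum_(i < n) c i * a i.

(** Summation by parts, as [1 / ((k+1)(k+2))] telescopes. *)
Let sum_Y a n : \sum_(k < n) S a k.+1 / (k.+1%:R * k.+2%:R) + S a n / n.+1%:R =
  \sum_(i < n) c i * a i / i.+1%:R.
Proof.
elim: n => [|n ih]; first by rewrite /S !big_ord0 mul0r addr0.
rewrite big_ord_recr/= [RHS]big_ord_recr/= -ih.
have -> : S a n.+1 = S a n + c n * a n by rewrite /S big_ord_recr.
have n1 : n.+1%:R != 0 :> R by rewrite pnatr_eq0.
have n2 : n.+2%:R != 0 :> R by rewrite pnatr_eq0.
rewrite -(natr1 n.+1) in n2 *; move: (c n * a n) (S a n) n1 n2 => x y.
move: (n.+1%:R : R) (\sum_(_ < _) _) => p z p0 p1.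
by field; rewrite p0.
Qed.

(** The inequality of arithmetic and geometric means for the terms [c i * a i], divided by the
    product of the weights. *)
Let prod_le a k : (forall i, 0 <= a i) ->
  \prod_(i < k.+1) a i <= (S a k.+1 / (k.+1%:R * k.+2%:R)) ^+ k.+1.
Proof.
move=> a0.
have := @leif_AGM R _ predT (fun i : 'I_k.+1 => c i * a i)
  (fun i _ => mulr_ge0 (ltW (c_gt0 i)) (a0 i)).
move=> /leifP /=.
rewrite card_ord big_split/= prod_c => h.
have {h} : k.+2%:R ^+ k.+1 * (\prod_(i < k.+1) a i) <= (S a k.+1 / k.+1%:R) ^+ k.+1.
  by move: h; case: ifP => _; [move=> /eqP ->|exact: ltW].
rewrite -ler_pdivlMl ?exprn_gt0// => /le_trans; apply.
rewrite -exprVn -exprMn mulrC -mulrA -invfM //.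
Qed.

(** Carleman's inequality for [a k = M k / M k.+1]. The products of these ratios telescope to
    [M 0 / M k], so their geometric means are, up to the factor [M 0], the roots in the series; a
    bound [K] on the sums of the ratios would bound that series. *)
Lemma carleman_ratio M : (forall k, 0 < M k) ->
  (\sum_(1 <= k <oo) (M k `^ (- k%:R^-1))%:E = +oo)%E ->
  sum_unbounded (fun k => M k / M k.+1).
Proof.
move=> M0 Moo K; apply: contrapT => /forallNP nK.
pose a k := M k / M k.+1.
have a0 k : 0 <= a k by rewrite divr_ge0// ltW.
have bK n : \sum_(i < n) a i <= K by rewrite leNgt; apply/negP/nK.
have prod_a k : \prod_(i < k) a i = M 0 / M k.
  elim: k => [|k ih]; first by rewrite big_ord0 divff// gt_eqF.
  by rewrite big_ord_recr/= ih /a mulrA divfK// gt_eqF.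
(* [D] dominates every root of [(M 0)^-1], being at least 1 and at least [(M 0)^-1]. *)
pose D := 1 + (M 0)^-1.
have D0 : 0 <= D by rewrite addr_ge0 ?invr_ge0 ?ltW.
have S0 n : 0 <= S a n by apply: sumr_ge0 => i _; rewrite mulr_ge0// ltW.
have root_le k : M k.+1 `^ (- k.+1%:R^-1) <= D * (S a k.+1 / (k.+1%:R * k.+2%:R)).
  set Y := S a k.+1 / _.
  have Y0 : 0 <= Y by rewrite divr_ge0.
  have le1 : (M k.+1)^-1 <= (D * Y) ^+ k.+1.
    rewrite exprMn (_ : (M k.+1)^-1 = (M 0)^-1 * \prod_(i < k.+1) a i); last first.
      by rewrite prod_a mulKf// gt_eqF.
    apply: ler_pM; last exact: prod_le.
    - by rewrite invr_ge0 ltW.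
    - by rewrite prodr_ge0.
    - apply: (@le_trans _ _ D); first by rewrite lerDr.
      by rewrite ler_eXnr// lerDl invr_ge0 ltW.
  have DY0 : 0 <= D * Y by rewrite mulr_ge0.
  rewrite -mulN1r powRrM powR_inv1 ?(ltW (M0 _))//.
  have -> : D * Y = ((D * Y) ^+ k.+1) `^ k.+1%:R^-1.
    by rewrite -powR_mulrn// -powRrM mulfV ?pnatr_eq0// powRr1.
  apply: ge0_ler_powR => //; rewrite ?nnegrE ?invr_ge0 ?exprn_ge0//; exact: ltW.
suff : (\sum_(1 <= k <oo) (M k `^ (- k%:R^-1))%:E <= (D * (expR 1 * K))%:E)%E.
  by rewrite Moo leye_eq.
apply: lime_le.
  by apply: is_cvg_nneseries => k _ _; rewrite lee_fin powR_ge0.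
apply: nearW => n; rewrite sumEFin lee_fin.
(* One more term is allowed so that the shift of index leaves the range [k < n]. *)
apply: (@le_trans _ _ (\sum_(1 <= k < n.+1) M k `^ (- k%:R^-1))).
  case: n => [|n]; first by rewrite !big_geq.
  by rewrite [leRHS]big_nat_recr//= lerDl powR_ge0.
rewrite big_add1/= big_mkord.
apply: (@le_trans _ _ (\sum_(k < n) D * (S a k.+1 / (k.+1%:R * k.+2%:R)))).
  by apply: ler_sum => k _; exact: root_le.
rewrite -mulr_sumr ler_wpM2l//.
apply: (@le_trans _ _ (\sum_(i < n) c i * a i / i.+1%:R)).
  by rewrite -sum_Y lerDl divr_ge0.
apply: le_trans (ler_wpM2l (expR_ge0 1) (bK n)).
rewrite mulr_sumr; apply: ler_sum => i _.
by rewrite mulrAC ler_wpM2r.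
Qed.

End carleman.

(** * Determinacy of moments *)

Lemma measurable_cos (R : realType) : measurable_fun setT (@cos R).
Proof. by apply: continuous_measurable_fun; exact: continuous_cos. Qed.

Section real_integrable.
Context d (T : measurableType d) (R : realType) (mu : {measure set T -> \bar R}).
Variables (D : set T) (mD : measurable D).
Implicit Types f g : T -> R.

Lemma integrable_measurableR f :
  mu.-integrable D (EFin \o f) -> measurable_fun D f.
Proof. by move=> /measurable_int/measurable_EFinP. Qed.

Lemma le_integrableR f g : measurable_fun D f ->
  (forall x, D x -> `|f x| <= g x) ->
  mu.-integrable D (EFin \o g) -> mu.-integrable D (EFin \o f).
Proof.
move=> mf fg; apply: le_integrable => //; first exact/measurable_EFinP.
by move=> x Dx; rewrite /= lee_fin (le_trans (fg _ Dx))// ler_norm.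
Qed.

Lemma integrableDR f g : mu.-integrable D (EFin \o f) ->
  mu.-integrable D (EFin \o g) ->
  mu.-integrable D (EFin \o (fun x => f x + g x)).
Proof. by move=> f_ g_; have := integrableD mD f_ g_. Qed.

Lemma integrableZR c f : mu.-integrable D (EFin \o f) ->
  mu.-integrable D (EFin \o (fun x => c * f x)).
Proof. by move=> f_; have := integrableZl mD c f_. Qed.

Lemma integrableBR f g : mu.-integrable D (EFin \o f) ->
  mu.-integrable D (EFin \o g) ->
  mu.-integrable D (EFin \o (fun x => f x - g x)).
Proof. by move=> f_ g_; have := integrableB mD f_ g_. Qed.

Lemma integrable_sumR (I : Type) (s : seq I) (c : I -> R) (f : I -> T -> R) :
  (forall i, mu.-integrable D (EFin \o f i)) ->
  mu.-integrable D (EFin \o (fun x => \sum_(i <- s) c i * f i x)).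
Proof.
move=> fI; elim: s => [|i s ih].
  by under eq_fun do rewrite big_nil; exact: integrable0.
under eq_fun do rewrite big_cons.
by apply: integrableDR => //; exact: integrableZR.
Qed.

Lemma Rintegral_sum (I : Type) (s : seq I) (c : I -> R) (f : I -> T -> R) :
  (forall i, mu.-integrable D (EFin \o f i)) ->
  \int[mu]_(x in D) (\sum_(i <- s) c i * f i x) =
  \sum_(i <- s) c i * \int[mu]_(x in D) f i x.
Proof.
move=> fI; elim: s => [|i s ih].
  rewrite big_nil; under eq_Rintegral do rewrite big_nil.
  by rewrite Rintegral_cst// mul0r.
rewrite big_cons -ih -RintegralZl// -RintegralD//.
- by apply: eq_Rintegral => x _; rewrite big_cons.
- exact: integrableZR.
- exact: integrable_sumR.
Qed.

Lemma ler_norm_Rintegral f g : mu.-integrable D (EFin \o f) ->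
  mu.-integrable D (EFin \o g) -> (forall x, D x -> `|f x| <= g x) ->
  `|\int[mu]_(x in D) f x| <= \int[mu]_(x in D) g x.
Proof.
move=> fI gI fg; apply: le_trans (le_normr_Rintegral mD fI) _.
by apply: le_Rintegral => //; exact: (integrable_norm fI).
Qed.

Lemma Rintegral_cauchy_schwarz f g :
  mu.-integrable D (EFin \o (fun x => f x * g x)) ->
  mu.-integrable D (EFin \o (fun x => f x ^+ 2)) ->
  mu.-integrable D (EFin \o (fun x => g x ^+ 2)) ->
  (\int[mu]_(x in D) (f x * g x)) ^+ 2 <=
  \int[mu]_(x in D) f x ^+ 2 * \int[mu]_(x in D) g x ^+ 2.
Proof.
move=> fg f2 g2.
set A := \int[mu]_(x in D) f x ^+ 2; set C := \int[mu]_(x in D) g x ^+ 2.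
set B := \int[mu]_(x in D) (f x * g x).
have quad l : 0 <= l ^+ 2 * A + - (2 * l) * B + C.
  have i1 := integrableZR (l ^+ 2) f2; have i2 := integrableZR (- (2 * l)) fg.
  rewrite -!RintegralZl// -RintegralD// -RintegralD//; last exact: integrableDR.
  apply: Rintegral_ge0 => x _.
  rewrite (_ : _ + _ = (l * f x - g x) ^+ 2) ?sqr_ge0//; ring.
have [A0|A0] := eqVneq A 0.
  have [->|B0] := eqVneq B 0; first by rewrite A0 mul0r expr0n.
  (* With [A = 0] the quadratic is affine in [l], and this [l] gives it the value -1. *)
  have := quad ((C + 1) / (2 * B)); rewrite A0 mulr0 add0r.
  rewrite [X in X + C](_ : _ = - (C + 1)); last by field.
  by rewrite opprD addrAC addNr add0r oppr_ge0 ler10.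
have A_gt0 : 0 < A.
  by rewrite lt0r A0/= Rintegral_ge0// => x _; exact: sqr_ge0.
have := quad (B / A).
rewrite (_ : _ + C = (A * C - B ^+ 2) / A); last by field.
by rewrite pmulr_lge0 ?invr_gt0// subr_ge0.
Qed.

End real_integrable.

Section cosine_moments.
Context d (T : measurableType d) (R : realType) (mu : {measure set T -> \bar R}).
Variables (D : set T) (mD : measurable D) (Z p g : T -> R).
Hypothesis mZ : measurable_fun D Z.
Hypothesis mg : measurable_fun D g.
Hypothesis g_le1 : forall x, D x -> `|g x| <= 1.
Hypothesis Zp_integrable :
  forall k, mu.-integrable D (EFin \o (fun x => Z x ^+ k * p x)).

Let mZp k : measurable_fun D (fun x => Z x ^+ k * p x).
Proof. exact: integrable_measurableR. Qed.

Let normZp_integrable k :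
  mu.-integrable D (EFin \o (fun x => `|Z x ^+ k * p x|)).
Proof. exact: (integrable_norm (Zp_integrable k)). Qed.

(** The [k]-th derivative in [t] of [g * p * cos (t * Z + b)], again with a phase shift in place of
    sines. The free phase [b] later serves to centre the Gaussians. *)
Definition cos_integrand (b : R) k t (x : T) : R :=
  g x * (Z x ^+ k * p x) * cos (t * Z x + b + k%:R * (pi / 2)).

Definition cos_moment (b : R) k t := \int[mu]_(x in D) cos_integrand b k t x.

Lemma cos_integrand_le b k t x : D x ->
  `|cos_integrand b k t x| <= `|Z x ^+ k * p x|.
Proof.
move=> Dx; rewrite /cos_integrand (normrM (g x * _)).
apply: (@le_trans _ _ `|g x * (Z x ^+ k * p x)|).
  by rewrite ler_piMr// cos_max.
by rewrite normrM ler_piMl// g_le1.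
Qed.

Lemma cos_integrable b k t : mu.-integrable D (EFin \o cos_integrand b k t).
Proof.
apply: le_integrableR (normZp_integrable k) => //; last exact: cos_integrand_le.
apply: measurable_funM; first exact: measurable_funM.
apply: measurableT_comp; first exact: measurable_cos.
apply: measurable_funD; last exact: measurable_cst.
apply: measurable_funD; last exact: measurable_cst.
exact: measurable_funM.
Qed.

Lemma cos_moment_le b k t :
  `|cos_moment b k t| <= \int[mu]_(x in D) `|Z x ^+ k * p x|.
Proof.
apply: ler_norm_Rintegral => //; first exact: cos_integrable.
exact: cos_integrand_le.
Qed.

(** The pointwise remainder [cos_taylor] is integrated, in place of differentiating under the
    integral sign. *)
Lemma cos_moment_taylor b k m t h :
  `|cos_moment b k (t + h) -
    \sum_(i < m) h ^+ i / i`!%:R * cos_moment b (k + i) t| <=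
  `|h| ^+ m / m`!%:R * \int[mu]_(x in D) `|Z x ^+ (k + m) * p x|.
Proof.
rewrite -Rintegral_sum//; last by move=> i; exact: cos_integrable.
rewrite -RintegralB//; last 2 first.
- exact: cos_integrable.
- by apply: integrable_sumR => // i; exact: cos_integrable.
rewrite -RintegralZl//; apply: ler_norm_Rintegral => //.
- apply: integrableBR => //; first exact: cos_integrable.
  by apply: integrable_sumR => // i; exact: cos_integrable.
- exact: integrableZR.
move=> x Dx; set u := t * Z x + b + k%:R * (pi / 2).
have -> : cos_integrand b k (t + h) x -
    \sum_(i < m) h ^+ i / i`!%:R * cos_integrand b (k + i) t x =
    g x * (Z x ^+ k * p x) * (cos (u + h * Z x) - cos_poly m u (h * Z x)).
  rewrite mulrBr; congr (_ * cos _ - _); first by rewrite /u; ring.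
  rewrite /cos_poly mulr_sumr; apply: eq_bigr => i _.
  rewrite /cos_integrand natrD mulrDl addrA -/u exprD exprMn; ring.
have := cos_taylor m u (h * Z x).
set E := cos _ - _ => Eh.
apply: (@le_trans _ _ (`|Z x ^+ k * p x| * (`|h * Z x| ^+ m / m`!%:R))).
  rewrite (normrM (_ * _) _) (normrM (g x) _); apply: ler_pM => //.
  by rewrite ler_piMl// g_le1.
rewrite exprD !normrM exprMn !normrX.
by rewrite le_eqVlt; apply/orP; left; apply/eqP; ring.
Qed.

End cosine_moments.

(** * Powers of cosines approaching a Gaussian *)

Section gaussian_approximation.
Context {R : realType}.
Implicit Types u w x y : R.

Lemma expRN_near w : 0 <= w -> `|expR (- w) - (1 - w)| <= w ^+ 2.
Proof.
move=> w0; have w1 : 0 < 1 + w by rewrite ltr_pwDl.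
have le1 := expR_ge1Dx (- w).
have le2 : expR (- w) <= 1 - w + w ^+ 2.
  rewrite expRN; apply: (@le_trans _ _ (1 + w)^-1).
    by rewrite lef_pV2 ?posrE ?expR_gt0// expR_ge1Dx.
  rewrite -[leLHS]mul1r ler_pdivrMr// -subr_ge0.
  have -> : (1 - w + w ^+ 2) * (1 + w) - 1 = w ^+ 3 by ring.
  exact: exprn_ge0.
by rewrite ler_norml; apply/andP; split; have := sqr_ge0 w; lra.
Qed.

(** Both functions are within [u ^+ 4 / 4] of [1 - u ^+ 2 / 2]. *)
Lemma cos_near_gauss u : `|cos u - expR (- (u ^+ 2 / 2))| <= u ^+ 4.
Proof.
have := cos_taylor 4 0 u; rewrite /cos_poly !big_ord_recl big_ord0 /=.
rewrite !add0r /bump/= !addn0 !add1n mul0r cos0 !mul1r.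
rewrite (_ : 2%:R * (pi / 2) = pi :> R); last by rewrite mulrC divfK.
rewrite (_ : 3%:R * (pi / 2) = pi + pi / 2 :> R); last by field.
rewrite cosDpihalf sinpi cos_pihalf cospi oppr0 !mulr0 !add0r addr0.
rewrite fact0 invr1 mulr1 mulrN1 => ct.
have := @expRN_near (u ^+ 2 / 2) (divr_ge0 (sqr_ge0 u) (ler0n _ 2)).
have u4 : 0 <= u ^+ 4 by rewrite (exprM u 2 2) sqr_ge0.
rewrite expr_div_n -exprM.
move: ct; rewrite -normrX (ger0_norm u4).
rewrite !ler_norml => /andP[a1 a2] /andP[b1 b2].
have f4 : u ^+ 4 / 4`!%:R <= u ^+ 4 / 4.
  by rewrite ler_wpM2l// lef_pV2 ?posrE ?ltr0n// ler_nat.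
have e2 : 2`!%N = 2%N by [].
rewrite e2 in a1 a2; rewrite (_ : 2 ^+ 2 = 4 :> R) in b1 b2; last by rewrite -natrX.
by apply/andP; split; lra.
Qed.

Lemma ler_dist_exprn x y n : `|x| <= 1 -> `|y| <= 1 ->
  `|x ^+ n - y ^+ n| <= n%:R * `|x - y|.
Proof.
move=> x1 y1; elim: n => [|n ih]; first by rewrite subrr normr0 mul0r.
have -> : x ^+ n.+1 - y ^+ n.+1 = x * (x ^+ n - y ^+ n) + (x - y) * y ^+ n.
  by rewrite !exprS; ring.
rewrite (le_trans (ler_normD _ _))// !normrM -natr1 mulrDl mul1r lerD//.
  by rewrite (le_trans _ ih)// ler_piMl.
by rewrite ler_piMr// normrX exprn_ile1.
Qed.

(** With [u = y / 2 ^+ j], each of the [4 ^ j] factors contributes an error of at most [u ^+ 4], in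
    total [y ^+ 4 / 4 ^+ j]. The weaker [2 ^+ j] matches [le_div_exp2_le0]. *)
Lemma cos_pow_near_gauss y j :
  `|cos (y / 2 ^+ j) ^+ (4 ^ j) - expR (- (y ^+ 2 / 2))| <= y ^+ 4 / 2 ^+ j.
Proof.
set u := y / 2 ^+ j.
have pow0 : 0 < 2 ^+ j :> R by exact: exprn_gt0.
have p4 : (4 ^ j)%:R = 2 ^+ j * 2 ^+ j :> R.
  by rewrite natrX -exprMn -natrM.
have yu : y = 2 ^+ j * u by rewrite /u mulrC divfK// gt_eqF.
have -> : expR (- (y ^+ 2 / 2)) = expR (- (u ^+ 2 / 2)) ^+ (4 ^ j).
  by rewrite -expRM_natl p4 yu; congr expR; ring.
apply: le_trans (ler_dist_exprn _ _ _) _.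
- exact: cos_max.
- by rewrite ger0_norm ?expR_ge0// -expR0 ler_expR oppr_le0 divr_ge0 ?sqr_ge0.
apply: (le_trans (ler_wpM2l _ (cos_near_gauss u))); first by rewrite ler0n.
have -> : y ^+ 4 / 2 ^+ j = (2 ^+ j * 2 ^+ j) * (2 ^+ j * u ^+ 4).
  by rewrite yu; field; rewrite gt_eqF.
rewrite p4 ler_wpM2l ?mulr_ge0 ?(ltW pow0)// ler_peMl//.
  by rewrite (exprM u 2 2) sqr_ge0.
by rewrite exprn_ege1// ler1n.
Qed.

End gaussian_approximation.

Section coordinate_products.
Context {T : Type} {R : realType} {I : Type}.
Implicit Types (X : I -> T -> R) (s : seq I).

(** Monomials are lists of indices with repetition: a further factor is a cons, a square is
    [s ++ s]. *)
Definition mono X s (x : T) : R := \prod_(i <- s) X i x.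

Lemma mono_nseq X i k s x : mono X (nseq k i ++ s) x = X i x ^+ k * mono X s x.
Proof.
elim: k => [|k ih]; first by rewrite expr0 mul1r.
by rewrite /mono /= big_cons -/(mono _ _ _) ih exprS mulrA.
Qed.

Lemma mono_catss X s x : mono X (s ++ s) x = mono X s x ^+ 2.
Proof. by rewrite /mono big_cat. Qed.

End coordinate_products.

(** * The moment problem in several variables *)

Section moment_problem.
Context d (T : measurableType d) (R : realType) (mu : {measure set T -> \bar R}).
Variables (D : set T) (mD : measurable D) (I : Type).
Implicit Types (X Y Z : I -> T -> R) (s : seq I).

(** Cauchy-Schwarz for [|w|] and [|p|]. With [w] the powers of one coordinate and [p] a fixed
    monomial, one constant serves all orders and only [m] varies with the order. *)
Lemma Rintegral_mul_le (w p : T -> R) (m : R) : 0 <= m ->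
  mu.-integrable D (EFin \o (fun x => w x * p x)) ->
  mu.-integrable D (EFin \o (fun x => w x ^+ 2)) ->
  mu.-integrable D (EFin \o (fun x => p x ^+ 2)) ->
  \int[mu]_(x in D) w x ^+ 2 <= m ^+ 2 ->
  \int[mu]_(x in D) `|w x * p x| <= Num.sqrt (\int[mu]_(x in D) p x ^+ 2) * m.
Proof.
move=> m0 wp w2 p2 wm.
have sqr_norm (h : T -> R) : (fun x => h x ^+ 2) = (fun x => `|h x| ^+ 2).
  by apply/funext => x; rewrite real_normK// num_real.
have norm_wp : (fun x => `|w x * p x|) = (fun x => `|w x| * `|p x|).
  by apply/funext => x; rewrite normrM.
have p2_ge0 : 0 <= \int[mu]_(x in D) p x ^+ 2.
  by apply: Rintegral_ge0 => x _; exact: sqr_ge0.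
rewrite -(@ler_pXn2r _ 2) ?nnegrE ?mulr_ge0 ?sqrtr_ge0//; last first.
  exact: Rintegral_ge0.
rewrite exprMn sqr_sqrtr// mulrC norm_wp sqr_norm.
rewrite (sqr_norm w) in w2 wm; rewrite (sqr_norm p) in p2 p2_ge0.
apply: le_trans (Rintegral_cauchy_schwarz mD _ w2 p2) _; last by rewrite ler_wpM2r.
by rewrite -norm_wp; exact: (integrable_norm wp).
Qed.

Variables (X Y : I -> T -> R) (M : I -> nat -> R).
Hypothesis X_integrable : forall s, mu.-integrable D (EFin \o mono X s).
Hypothesis Y_integrable : forall s, mu.-integrable D (EFin \o mono Y s).
Hypothesis XY : forall s,
  \int[mu]_(x in D) mono X s x = \int[mu]_(x in D) mono Y s x.
Hypothesis M_gt0 : forall i k, 0 < M i k.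
Hypothesis M_log_convex : forall i, log_convex (M i).
Hypothesis M_diverges : forall i, sum_unbounded (fun k => M i k / M i k.+1).
Hypothesis XM : forall i k,
  \int[mu]_(x in D) (X i x ^+ k) ^+ 2 <= M i k ^+ 2.
Hypothesis YM : forall i k,
  \int[mu]_(x in D) (Y i x ^+ k) ^+ 2 <= M i k ^+ 2.

(* [g] and [g'] play the roles of [phi \o X] and [phi \o Y] for a bounded
   function [phi] of the coordinates. *)
Definition same_moments (g g' : T -> R) :=
  [/\ measurable_fun D g, measurable_fun D g',
      forall x, D x -> `|g x| <= 1, forall x, D x -> `|g' x| <= 1 &
      forall s, \int[mu]_(x in D) (g x * mono X s x) =
                \int[mu]_(x in D) (g' x * mono Y s x)].

Lemma same_moments1 : same_moments (cst 1) (cst 1).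
Proof.
split => // [x _|x _|s]; rewrite ?normr1//.
under eq_Rintegral do rewrite mul1r.
by under [RHS]eq_Rintegral do rewrite mul1r.
Qed.

Lemma bounded_mono_integrable (Z : I -> T -> R) (g : T -> R) s :
  (forall s, mu.-integrable D (EFin \o mono Z s)) ->
  measurable_fun D g -> (forall x, D x -> `|g x| <= 1) ->
  mu.-integrable D (EFin \o (fun x => g x * mono Z s x)).
Proof.
move=> Zs mg g1; apply: le_integrableR (integrable_norm (Zs s)) => //.
  by apply: measurable_funM => //; exact: integrable_measurableR (Zs s).
by move=> x Dx; rewrite normrM ler_piMl// g1.
Qed.

Section coordinate.
Variables (Z : I -> T -> R) (i : I) (s : seq I) (g : T -> R).
Hypothesis Z_integrable : forall s, mu.-integrable D (EFin \o mono Z s).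
Hypothesis ZM : forall k,
  \int[mu]_(x in D) (Z i x ^+ k) ^+ 2 <= M i k ^+ 2.
Hypothesis mg : measurable_fun D g.
Hypothesis g_le1 : forall x, D x -> `|g x| <= 1.

Lemma coordinate_measurable : measurable_fun D (Z i).
Proof.
have := integrable_measurableR (Z_integrable [:: i]).
by apply: eq_measurable_fun => x _; rewrite /mono big_seq1.
Qed.

Lemma Xp_integrable k :
  mu.-integrable D (EFin \o (fun x => Z i x ^+ k * mono Z s x)).
Proof.
rewrite (_ : (fun x => _) = mono Z (nseq k i ++ s))//.
by apply/funext => x; rewrite mono_nseq.
Qed.

Lemma Xp_le k : \int[mu]_(x in D) `|Z i x ^+ k * mono Z s x| <=
  Num.sqrt (\int[mu]_(x in D) mono Z s x ^+ 2) * M i k.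
Proof.
apply: Rintegral_mul_le; rewrite ?(ltW (M_gt0 _ _))//; first exact: Xp_integrable.
- rewrite (_ : (fun x => _) = mono Z (nseq (k * 2) i))//.
  by apply/funext => x; rewrite -[nseq _ _]cats0 mono_nseq /mono big_nil mulr1 exprM.
- rewrite (_ : (fun x => _) = mono Z (s ++ s))//.
  by apply/funext => x; rewrite mono_catss.
Qed.

End coordinate.

(** For each test monomial [s], the difference of the two cosine moments, as a function of [t],
    satisfies the hypotheses of [bang_uniqueness] with the sequence [M i]. *)
Lemma same_moments_cos (i : I) t b (g g' : T -> R) : same_moments g g' ->
  same_moments (fun x => g x * cos (t * X i x + b))
               (fun x => g' x * cos (t * Y i x + b)).
Proof.
move=> [mg mg' g1 g'1 gg'].
have mX := coordinate_measurable i X_integrable.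
have mY := coordinate_measurable i Y_integrable.
have mcos (Z : T -> R) : measurable_fun D Z ->
    measurable_fun D (fun x => cos (t * Z x + b)).
  move=> mZ; apply: measurableT_comp; first exact: measurable_cos.
  by apply: measurable_funD => //; exact: measurable_funM.
have le1 (h Z : T -> R) x : `|h x| <= 1 -> `|h x * cos (t * Z x + b)| <= 1.
  by move=> h1; rewrite normrM mulr_ile1// cos_max.
split; [exact: measurable_funM (mcos _ _)|exact: measurable_funM (mcos _ _)|
  by move=> x Dx; apply/le1/g1|by move=> x Dx; apply/le1/g'1|move=> s].
have Xp k := Xp_integrable i s X_integrable k.
have Yp k := Xp_integrable i s Y_integrable k.
have Xb k := Xp_le s X_integrable (XM i) k.
have Yb k := Xp_le s Y_integrable (YM i) k.
pose F k t := cos_moment mu D (X i) (mono X s) g b k t -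
              cos_moment mu D (Y i) (mono Y s) g' b k t.
set CX := Num.sqrt _ in Xb; set CY := Num.sqrt _ in Yb.
have e0 (Z : I -> T -> R) (h : T -> R) :
    \int[mu]_(x in D) (h x * cos (t * Z i x + b) * mono Z s x) =
    cos_moment mu D (Z i) (mono Z s) h b 0 t.
  apply: eq_Rintegral => x _.
  by rewrite /cos_integrand mul0r addr0 expr0 mul1r mulrAC.
suff : F 0%N t = 0 by move=> /eqP; rewrite subr_eq0 !e0 => /eqP.
apply: (@bang_uniqueness _ F (M i) (CX + CY)) => //.
- move=> k u; rewrite (le_trans (ler_normB _ _))// mulrDl lerD//.
    exact: le_trans (cos_moment_le mD mX mg g1 Xp b k u) (Xb k).
  exact: le_trans (cos_moment_le mD mY mg' g'1 Yp b k u) (Yb k).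
- move=> k m u h.
  have := cos_moment_taylor mD mX mg g1 Xp b k m u h.
  have := cos_moment_taylor mD mY mg' g'1 Yp b k m u h.
  set SY := \sum_(_ < _) _; set SX := \sum_(_ < _) _ => tY tX.
  have -> : \sum_(j < m) h ^+ j / j`!%:R * F (k + j)%N u = SX - SY.
    by rewrite -sumrB; apply: eq_bigr => j _; rewrite mulrBr.
  rewrite /F opprB addrACA [X in `|X|](_ : _ =
    (cos_moment mu D (X i) (mono X s) g b k (u + h) - SX) -
    (cos_moment mu D (Y i) (mono Y s) g' b k (u + h) - SY)); last by ring.
  rewrite (le_trans (ler_normB _ _))// mulrDl lerD//.
    rewrite (le_trans tX)// mulrCA ler_wpM2l// divr_ge0 ?exprn_ge0//.
  by rewrite (le_trans tY)// mulrCA ler_wpM2l// divr_ge0 ?exprn_ge0.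
(* Flatness: at [t = 0] the cosine is a constant, and what remains is the known equality of moments
   for the longer list [nseq k i ++ s]. *)
- move=> k; rewrite /F /cos_moment /cos_integrand.
  apply/eqP; rewrite subr_eq0; apply/eqP.
  have e (Z : I -> T -> R) (h : T -> R) :
     (fun x => h x * (Z i x ^+ k * mono Z s x) *
         cos (0 * Z i x + b + k%:R * (pi / 2))) =
     (fun x => h x * mono Z (nseq k i ++ s) x * cos (b + k%:R * (pi / 2))).
    by apply/funext => x; rewrite mul0r add0r mono_nseq.
  by rewrite !e !RintegralZr ?gg'//; exact: bounded_mono_integrable.
Qed.

Lemma same_moments_cosX (i : I) t b n (g g' : T -> R) : same_moments g g' ->
  same_moments (fun x => g x * cos (t * X i x + b) ^+ n)
               (fun x => g' x * cos (t * Y i x + b) ^+ n).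
Proof.
move=> gg'; elim: n => [|n /(same_moments_cos i t b)].
  rewrite (_ : (fun x => _) = g); last by apply/funext => x; rewrite mulr1.
  by rewrite (_ : (fun x => _) = g')//; apply/funext => x; rewrite mulr1.
by congr same_moments; apply/funext => x; rewrite exprSr mulrA.
Qed.

(** Convexity of the fourth power. It bounds the error of the Gaussian approximation by integrable
    monomials. *)
Lemma pow4_le (c z a : R) :
  `|(c * (z - a)) ^+ 4| <= 8 * c ^+ 4 * `|z ^+ 4| + 8 * c ^+ 4 * a ^+ 4.
Proof.
have pow4 (y : R) : 0 <= y ^+ 4 by rewrite (exprM y 2 2) sqr_ge0.
rewrite !ger0_norm// exprMn.
rewrite [leRHS](_ : _ = c ^+ 4 * (8 * (z ^+ 4 + a ^+ 4))); last by ring.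
rewrite ler_wpM2l//.
rewrite -subr_ge0 (_ : _ - _ = (z ^+ 2 + 2 * z * a + a ^+ 2 ) ^+ 2 +
   6 * (z ^+ 2 - a ^+ 2) ^+ 2); last by ring.
by rewrite addr_ge0 ?sqr_ge0// mulr_ge0 ?sqr_ge0.
Qed.

Lemma gauss_factor_measurable (Z : T -> R) (a sg : R) : measurable_fun D Z ->
  measurable_fun D (fun x => expR (- ((sg * (Z x - a)) ^+ 2 / 2))).
Proof.
move=> mZ; apply: measurableT_comp; first exact: measurable_expR.
apply: measurable_funN; apply: measurable_funM => //.
by apply: measurable_funX; apply: measurable_funM => //; exact: measurable_funB.
Qed.

Lemma gauss_factor_le1 (y : R) : `|expR (- (y ^+ 2 / 2))| <= 1.
Proof.
by rewrite ger0_norm ?expR_ge0// -expR0 ler_expR oppr_le0 divr_ge0 ?sqr_ge0.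
Qed.

(** The parameter [sg] is the inverse of the width: large [sg] means a narrow Gaussian. *)
Definition gauss_prod Z (r : seq I) (a : I -> R) (sg : R) (x : T) : R :=
  \prod_(i <- r) expR (- ((sg * (Z i x - a i)) ^+ 2 / 2)).

Lemma gauss_prod_measurable Z r a sg : (forall i, measurable_fun D (Z i)) ->
  measurable_fun D (gauss_prod Z r a sg).
Proof.
move=> mZ; elim: r => [|i r ih].
  rewrite (_ : gauss_prod _ _ _ _ = cst 1)//.
  by apply/funext => x; rewrite /gauss_prod big_nil.
have -> : gauss_prod Z (i :: r) a sg =
    (fun x => expR (- ((sg * (Z i x - a i)) ^+ 2 / 2)) * gauss_prod Z r a sg x).
  by apply/funext => x; rewrite /gauss_prod big_cons.
by apply: measurable_funM => //; exact: gauss_factor_measurable.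
Qed.

(** The error of [cos_pow_near_gauss] at [y = sg * (Z i x - a)] is integrated against the monomial.
    Finite moments make [K] finite, and it does not depend on [j]. *)
Lemma gauss_factor_near (Z : I -> T -> R) (i : I) (a sg : R) s (g : T -> R) :
  (forall s, mu.-integrable D (EFin \o mono Z s)) ->
  measurable_fun D g -> (forall x, D x -> `|g x| <= 1) ->
  exists K, forall j,
  `|\int[mu]_(x in D) (g x * expR (- ((sg * (Z i x - a)) ^+ 2 / 2)) * mono Z s x) -
    \int[mu]_(x in D) (g x *
       cos (sg / 2 ^+ j * Z i x + - (sg * a) / 2 ^+ j) ^+ (4 ^ j) * mono Z s x)|
  <= K / 2 ^+ j.
Proof.
move=> Zs mg g1; pose w x := (sg * (Z i x - a)) ^+ 4 * mono Z s x.
have mZ := coordinate_measurable i Zs.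
have mm := integrable_measurableR (Zs s).
have wI : mu.-integrable D (EFin \o w).
  apply: (le_integrableR mD (g := fun x =>
    8 * sg ^+ 4 * `|Z i x ^+ 4 * mono Z s x| +
    8 * sg ^+ 4 * a ^+ 4 * `|mono Z s x|)) => //.
  - apply: measurable_funM => //; apply: measurable_funX.
    by apply: measurable_funM => //; exact: measurable_funB.
  - move=> x _; rewrite /w (normrM _ (mono Z s x)) (normrM _ (mono Z s x)).
    by rewrite mulrA -mulrDl ler_wpM2r// pow4_le.
  - apply: integrableDR => //; apply: integrableZR => //.
      exact: (integrable_norm (Xp_integrable i s Zs 4)).
    exact: (integrable_norm (Zs s)).
exists (\int[mu]_(x in D) `|w x|) => j.
have intg (h : T -> R) : measurable_fun D h -> (forall x, `|h x| <= 1) ->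
    mu.-integrable D (EFin \o (fun x => g x * h x * mono Z s x)).
  move=> mh h1; apply: bounded_mono_integrable => //; first exact: measurable_funM.
  by move=> x Dx; rewrite normrM mulr_ile1// g1.
have i1 := intg _ (gauss_factor_measurable a sg mZ) (fun x => gauss_factor_le1 _).
have i2 : mu.-integrable D (EFin \o (fun x => g x *
    cos (sg / 2 ^+ j * Z i x + - (sg * a) / 2 ^+ j) ^+ (4 ^ j) * mono Z s x)).
  apply: intg => [|x]; last by rewrite normrX exprn_ile1// cos_max.
  apply: measurable_funX; apply: measurableT_comp; first exact: measurable_cos.
  by apply: measurable_funD => //; exact: measurable_funM.
rewrite -RintegralB// -RintegralZr//; last exact: (integrable_norm wI).
apply: ler_norm_Rintegral => //.
- exact: integrableBR.
- under eq_fun do rewrite mulrC.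
  by apply: integrableZR => //; exact: (integrable_norm wI).
move=> x Dx.
have -> : sg / 2 ^+ j * Z i x + - (sg * a) / 2 ^+ j =
  sg * (Z i x - a) / 2 ^+ j by ring.
rewrite -mulrBl -mulrBr (normrM (g x * _) _) (normrM (g x) _) (distrC (expR _)).
have := cos_pow_near_gauss (sg * (Z i x - a)) j.
set E := `|_ - _| => Eh.
rewrite /w normrM [leRHS]mulrAC ler_wpM2r//.
apply: (@le_trans _ _ E); first by rewrite ler_piMl ?g1// normr_ge0.
by apply: le_trans Eh _; rewrite ler_wpM2r ?ler_norm.
Qed.

Lemma same_moments_gauss (i : I) a sg (g g' : T -> R) : same_moments g g' ->
  same_moments (fun x => g x * expR (- ((sg * (X i x - a)) ^+ 2 / 2)))
               (fun x => g' x * expR (- ((sg * (Y i x - a)) ^+ 2 / 2))).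
Proof.
move=> gg'; have [mg mg' g1 g'1 _] := gg'.
have mX := coordinate_measurable i X_integrable.
have mY := coordinate_measurable i Y_integrable.
split.
- exact/measurable_funM/gauss_factor_measurable.
- exact/measurable_funM/gauss_factor_measurable.
- by move=> x Dx; rewrite normrM mulr_ile1// ?g1 ?gauss_factor_le1.
- by move=> x Dx; rewrite normrM mulr_ile1// ?g'1 ?gauss_factor_le1.
move=> s.
have [KX hX] := gauss_factor_near i a sg s X_integrable mg g1.
have [KY hY] := gauss_factor_near i a sg s Y_integrable mg' g'1.
apply/eqP; rewrite -subr_eq0 -normr_le0.
apply: (@le_div_exp2_le0 _ _ (KX + KY)) => j.
have [_ _ _ _ /(_ s) cc] :=
  same_moments_cosX i (sg / 2 ^+ j) (- (sg * a) / 2 ^+ j) (4 ^ j) gg'.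
have := hX j; have := hY j; rewrite cc.
set CC := (X in `|_ - X| <= KY / _ -> _) => hY' hX'.
set GX := Rintegral _ _ _ in hX' *; set GY := Rintegral _ _ _ in hY' *.
have -> : GX - GY = (GX - CC) - (GY - CC) by ring.
by rewrite (le_trans (ler_normB _ _))// mulrDl lerD.
Qed.

Lemma gauss_moments r a sg :
  \int[mu]_(x in D) gauss_prod X r a sg x = \int[mu]_(x in D) gauss_prod Y r a sg x.
Proof.
suff [_ _ _ _ /(_ [::])] :
    same_moments (gauss_prod X r a sg) (gauss_prod Y r a sg).
  rewrite /mono; under eq_Rintegral do rewrite big_nil mulr1.
  by under [in X in _ = X -> _]eq_Rintegral do rewrite big_nil mulr1.
elim: r => [|i r /(same_moments_gauss i (a i) sg)].
  have := same_moments1; congr same_moments;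
    by apply/funext => x; rewrite /gauss_prod big_nil.
by congr same_moments; apply/funext => x; rewrite /gauss_prod big_cons mulrC.
Qed.

End moment_problem.

(** * Real coordinates, measurability and volume on C^n *)

Section coordinates.
Context {R : realType} {n : nat}.
Local Notation C := R[i].
Implicit Types (z w : 'rV[C]_n) (i : 'I_n * bool).

Definition real_coord i z : R :=
  if i.2 then complex.Re (z 0 i.1) else complex.Im (z 0 i.1).

Lemma Re_subc (x y : C) : complex.Re (x - y) = complex.Re x - complex.Re y.
Proof. by case: x; case: y. Qed.

Lemma Im_subc (x y : C) : complex.Im (x - y) = complex.Im x - complex.Im y.
Proof. by case: x; case: y. Qed.

Lemma norm_normc (x : C) : `|x| = (ComplexField.Normc.normc x)%:C%C.
Proof. by rewrite normc_def; case: x. Qed.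

Lemma ler_normc_ReDIm (x : C) :
  ComplexField.Normc.normc x <= `|complex.Re x| + `|complex.Im x|.
Proof.
case: x => a b /=; rewrite -(@ler_pXn2r _ 2) ?nnegrE ?sqrtr_ge0 ?addr_ge0//.
rewrite sqr_sqrtr ?addr_ge0 ?sqr_ge0// sqrrD !real_normK ?num_real//.
by rewrite addrAC lerDl mulrn_wge0// mulr_ge0.
Qed.

Lemma ler_norm_Re (x : C) : `|complex.Re x| <= ComplexField.Normc.normc x.
Proof.
case: x => a b /=; rewrite -sqrtr_sqr ler_wsqrtr// lerDl sqr_ge0 //.
Qed.

Lemma ler_norm_Im (x : C) : `|complex.Im x| <= ComplexField.Normc.normc x.
Proof.
case: x => a b /=; rewrite -sqrtr_sqr ler_wsqrtr// lerDr sqr_ge0 //.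
Qed.

Lemma nbhs_box z (U : set 'rV[C]_n) : nbhs z U ->
  exists2 e : R, 0 < e &
    forall w, (forall i, `|real_coord i w - real_coord i z| < e) -> U w.
Proof.
move=> /nbhs_ballP[e /= e0 eU].
(* The radius lies in [R[i]], where being positive includes having imaginary part 0. *)
have e0' : 0 < complex.Re e by move: e0; rewrite ltcE => /andP[].
exists (complex.Re e / 2) => [|w wz]; first by rewrite divr_gt0.
apply: eU; split => // k j; rewrite (ord1 k) -ball_normE /=.
rewrite norm_normc ltcE/= ger0_Im ?(ltW e0)// eqxx/=.
apply: le_lt_trans (ler_normc_ReDIm _) _; rewrite Re_subc Im_subc.
have := wz (j, true); have := wz (j, false); rewrite /real_coord/= => h1 h2.
by rewrite distrC (splitr (complex.Re e)) ltrD// distrC.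
Qed.

Lemma box_nbhs z (e : R) : 0 < e ->
  nbhs z [set w | forall i, `|real_coord i w - real_coord i z| < e].
Proof.
move=> e0; apply/nbhs_ballP; exists e%:C%C => /=; first by rewrite ltcR.
move=> w [_ wz] [j b].
have := wz ord0 j; rewrite -ball_normE /= norm_normc ltcR => /(le_lt_trans _); apply.
rewrite distrC /real_coord/=; case: b.
  by rewrite -Re_subc ler_norm_Re.
by rewrite -Im_subc ler_norm_Im.
Qed.

End coordinates.
Section measurability.
Context {R : realType} {n : nat}.
Local Notation Tn := (n.-tuple (measurableTypeR R * measurableTypeR R)).
Local Notation I := ('I_n * bool)%type.

Lemma measurable_coord (i : I) :
  measurable_fun setT (fun t : Tn => real_coord i (toCn t)).
Proof.
have m1 : measurable_fun setT (fun t : Tn => (tnth t i.1).1).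
  apply: (measurableT_comp (f := fst)) => //; exact: measurable_tnth.
have m2 : measurable_fun setT (fun t : Tn => (tnth t i.1).2).
  apply: (measurableT_comp (f := snd)) => //; exact: measurable_tnth.
rewrite /real_coord; case: i m1 m2 => j [] /= m1 m2.
  by apply: eq_measurable_fun m1 => t _; rewrite mxE.
by apply: eq_measurable_fun m2 => t _; rewrite mxE.
Qed.

Lemma measurable_box (a : I -> R) (e : R) :
  measurable [set t : Tn | forall i, `|real_coord i (toCn t) - a i| < e].
Proof.
rewrite (_ : mkset _ = \bigcap_(i in [set: I])
    [set t : Tn | `|real_coord i (toCn t) - a i| < e]); last first.
  by apply/seteqP; split => t /= h i; [move=> _|]; exact: h.
apply: fin_bigcap_measurable => // i _.
rewrite -[X in measurable X]setTI; apply: measurable_fun_ltr => //.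
apply: measurableT_comp => //; apply: measurable_funB => //.
exact: measurable_coord.
Qed.

(** An open set is the union of the countably many boxes with rational centre and radius [1 / (k+1)]
    that it contains. *)
Lemma measurable_preimage_toCn (Omega : set 'rV[R[i]]_n) :
  open Omega -> measurable (@toCn R n @^-1` Omega).
Proof.
move=> oO.
pose B (p : {ffun I -> rat} * nat) : set 'rV[R[i]]_n :=
  [set w | forall i, `|real_coord i w - ratr (p.1 i)| < p.2.+1%:R^-1].
rewrite (_ : _ @^-1` _ = \bigcup_p
   [set t : Tn | B p `<=` Omega /\ B p (toCn t)]); last first.
  apply/seteqP; split=> [t /= Ot|t [p _ [pO pt]]]; last exact: pO.
  have [e e0 eO] := nbhs_box (open_nbhs_nbhs (conj oO Ot)).
  (* Two points of one box differ, in each real coordinate, by less than twice its radius. *)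
  have [k ke] : exists k : nat, k.+1%:R^-1 < e / 2.
    exists (Num.bound (e / 2)^-1).
    rewrite -[ltRHS]invrK ltf_pV2 ?posrE ?invr_gt0 ?divr_gt0//.
    rewrite (lt_trans (archi_boundP _)) ?ltr_nat//.
    by rewrite invr_ge0 divr_ge0// ltW.
  have /choice[q hq] : forall i : I, exists q : rat,
      `|real_coord i (toCn t) - ratr q| < k.+1%:R^-1.
    move=> i; have [] := @rat_in_itvoo R (real_coord i (toCn t) - k.+1%:R^-1)
      (real_coord i (toCn t) + k.+1%:R^-1).
      by rewrite ltrBlDr -addrA ltrDl addr_gt0.
    move=> q; rewrite in_itv/= => /andP[q1 q2]; exists q.
    by rewrite distrC ltr_distl q1.
  exists ([ffun i => q i], k) => //; split => /= [w Bw|i]; last by rewrite ffunE.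
  apply: eO => i; have := Bw i; have := hq i; rewrite /= ffunE => h1 h2.
  rewrite (splitr e) -[_ - _](subrKA (ratr (q i))) (le_lt_trans (ler_normD _ _))//.
  rewrite ltrD// ?(lt_trans h2)//.
  by rewrite distrC (lt_trans h1).
apply: countable_bigcupT_measurable => [|p]; first exact: countableP.
have [BO|nBO] := pselect (B p `<=` Omega).
  rewrite (_ : mkset _ = [set t : Tn | B p (toCn t)]).
    exact: measurable_box.
  by apply/seteqP; split => [t []|t].
by rewrite (_ : mkset _ = set0)//; apply/seteqP; split => // t [].
Qed.

End measurability.

Section box_volume.

Lemma measurable_cylinder d (T : measurableType d) n (S : 'I_n -> set T) :
  (forall j, measurable (S j)) ->
  measurable [set t : n.-tuple T | forall j, S j (tnth t j)].
Proof.
move=> mS; rewrite (_ : mkset _ = \bigcap_(j in [set: 'I_n])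
    [set t : n.-tuple T | S j (tnth t j)]); last first.
  by apply/seteqP; split => t /= h j; [move=> _|]; exact: h.
apply: fin_bigcap_measurable => // j _.
by rewrite -[X in measurable X]setTI; exact: measurable_tnth.
Qed.

Lemma power_measure_cylinder_gt0 d (T : measurableType d) (R : realType)
    (m : {sigma_finite_measure set T -> \bar R}) n (S : 'I_n -> set T) :
  (forall j, measurable (S j)) -> (forall j, 0 < m (S j))%E ->
  (0 < power_measure m n [set t | forall j, S j (tnth t j)])%E.
Proof.
elim: n S => [|n ih] S mS S0.
  rewrite /= diracE mem_set//; by case.
rewrite /= /cons_measure /pushforward.
set P := [set t : n.-tuple T | forall j : 'I_n, S (lift ord0 j) (tnth t j)].
rewrite [X in sigma_finite_product _ _ X](_ : _ = S ord0 `*` P); last first.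
  apply/seteqP; split => [[x t] /= h|[x t] /= [h1 h2] j].
    split; first by have := h ord0; rewrite tnth0.
    by move=> j; have := h (lift ord0 j); rewrite tnthS.
  by case: (unliftP ord0 j) => [k|] ->; [rewrite tnthS; exact: h2|rewrite tnth0].
rewrite /sigma_finite_product product_measure1E//.
  by rewrite mule_gt0 ?S0//; exact: (ih _ (fun j => mS _) (fun j => S0 _)).
exact: (@measurable_cylinder _ _ n (fun j : 'I_n => S (lift ord0 j))).
Qed.

Lemma volume_box_gt0 (R : realType) n (a : 'I_n * bool -> R) (e : R) : 0 < e ->
  (0 < volume n [set t | forall i, `|real_coord i (toCn t) - a i| < e]%R)%E.
Proof.
move=> e0.
pose S j : set (measurableTypeR R * measurableTypeR R) :=
  ball (a (j, true) : R) e `*` ball (a (j, false) : R) e.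
rewrite [X in volume _ X](_ : _ = [set t | forall j, S j (tnth t j)]); last first.
  apply/seteqP; split => [t /= h j|t /= h [j b]].
    split; rewrite -ball_normE/= distrC.
      by have := h (j, true); rewrite /real_coord mxE.
    by have := h (j, false); rewrite /real_coord mxE.
  have [] := h j; rewrite -!ball_normE/= => h1 h2.
  by rewrite /real_coord mxE/=; case: b; rewrite distrC.
apply: power_measure_cylinder_gt0 => j.
  by apply: measurableX; exact: measurable_ball.
rewrite [X in (_ < X)%E](_ : _ = (lebesgue_measure \x lebesgue_measure)%E
  ((ball (a (j, true) : R) e : set (measurableTypeR R)) `*`
   (ball (a (j, false) : R) e : set (measurableTypeR R))))//.
rewrite product_measure1E; [|exact: measurable_ball..].
have ball_gt0 (x : R) : (0 < @lebesgue_measure R (ball x e))%E.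
  by rewrite lebesgue_measure_ball ?(ltW e0)// lte_fin mulrn_wgt0.
by apply: mule_gt0; exact: ball_gt0.
Qed.

End box_volume.

Section complex_measurable.
Context d (T : measurableType d) (R : realType) (D : set T).
Local Notation C := R[i].
Local Notation normc := ComplexField.Normc.normc.
Implicit Types f g : T -> C.

Definition measurable_cfun f :=
  measurable_fun D (fun t => complex.Re (f t)) /\
  measurable_fun D (fun t => complex.Im (f t)).

Lemma measurable_cfun_cst (c : C) : measurable_cfun (fun=> c).
Proof. by split; exact: measurable_cst. Qed.

Lemma Re_mulc (x y : C) : complex.Re (x * y) =
  complex.Re x * complex.Re y - complex.Im x * complex.Im y.
Proof. by case: x; case: y. Qed.

Lemma Im_mulc (x y : C) : complex.Im (x * y) =
  complex.Re x * complex.Im y + complex.Im x * complex.Re y.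
Proof. by case: x; case: y. Qed.

Lemma measurable_cfunM f g : measurable_cfun f -> measurable_cfun g ->
  measurable_cfun (fun t => f t * g t).
Proof.
move=> [f1 f2] [g1 g2]; split.
  by under eq_fun do rewrite Re_mulc; apply: measurable_funB; exact: measurable_funM.
by under eq_fun do rewrite Im_mulc; apply: measurable_funD; exact: measurable_funM.
Qed.

Lemma measurable_cfunX f k : measurable_cfun f -> measurable_cfun (fun t => f t ^+ k).
Proof.
move=> mf; elim: k => [|k ih].
  by under eq_fun do rewrite expr0; exact: measurable_cfun_cst.
by under eq_fun do rewrite exprS; exact: measurable_cfunM.
Qed.

Lemma measurable_cfun_prod (I : Type) (s : seq I) (F : I -> T -> C) :
  (forall i, measurable_cfun (F i)) ->
  measurable_cfun (fun t => \prod_(i <- s) F i t).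
Proof.
move=> mF; elim: s => [|i s ih].
  by under eq_fun do rewrite big_nil; exact: measurable_cfun_cst.
by under eq_fun do rewrite big_cons; exact: measurable_cfunM.
Qed.

Lemma measurable_cfun_conj f : measurable_cfun f ->
  measurable_cfun (fun t => conjc (f t)).
Proof.
move=> [f1 f2]; split.
  by apply: eq_measurable_fun f1 => t _; case: (f t).
apply: eq_measurable_fun (measurable_funN f2) => t _ /=; by case: (f t).
Qed.

Lemma sqr_normc (x : C) : normc x ^+ 2 = complex.Re x ^+ 2 + complex.Im x ^+ 2.
Proof. by case: x => a b /=; rewrite sqr_sqrtr// addr_ge0 ?sqr_ge0. Qed.

Lemma normc_ge0 (x : C) : 0 <= normc x.
Proof. by case: x => a b /=; exact: sqrtr_ge0. Qed.

Lemma measurable_sqr_normc f : measurable_cfun f ->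
  measurable_fun D (fun t => normc (f t) ^+ 2).
Proof.
move=> [f1 f2]; under eq_fun do rewrite sqr_normc.
by apply: measurable_funD; exact: measurable_funX.
Qed.

End complex_measurable.

Section square_integrable.
Context {R : realType} {n : nat}.
Local Notation C := R[i].
Local Notation normc := ComplexField.Normc.normc.
Local Notation Tn := (n.-tuple (measurableTypeR R * measurableTypeR R)).
Variable Omega : set 'rV[C]_n.
Hypothesis oOmega : open Omega.
Let D := @toCn R n @^-1` Omega.
Let mu := @volume R n.

Lemma measurable_cfun_coord (j : 'I_n) :
  measurable_cfun D (fun t : Tn => toCn t 0 j).
Proof.
by split; apply: measurable_funTS;
  [exact: (measurable_coord (j, true))|exact: (measurable_coord (j, false))].
Qed.

Lemma measurable_monomial (alpha : 'I_n -> nat) :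
  measurable_cfun D (fun t : Tn => monomial alpha (toCn t)).
Proof.
apply: measurable_cfun_prod => j; apply: measurable_cfunX.
exact: measurable_cfun_coord.
Qed.

Lemma sqr_L2norm (f : 'rV[C]_n -> C) :
  (L2norm Omega f `^ 2 = \int[mu]_(t in D) (normc (f (toCn t)) ^+ 2)%:E)%E.
Proof.
rewrite /L2norm powR_Lnorm// [RHS]integral_mkcond.
apply: eq_integral => t _ /=; rewrite /patch; case: ifPn => _.
  by rewrite ger0_norm ?normc_ge0// powR_mulrn// normc_ge0.
by rewrite /point/= normr0 powR0.
Qed.

Lemma L2norm_integrable (f : 'rV[C]_n -> C) :
  measurable_cfun D (fun t : Tn => f (toCn t)) -> (L2norm Omega f < +oo)%E ->
  mu.-integrable D (EFin \o (fun t => normc (f (toCn t)) ^+ 2)).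
Proof.
move=> mf foo; apply/integrableP; split.
  by apply/measurable_EFinP; exact: measurable_sqr_normc.
under eq_integral do rewrite /= ger0_norm ?exprn_ge0 ?normc_ge0//.
by rewrite -sqr_L2norm poweR_lty.
Qed.

Lemma sqr_fine_L2norm (f : 'rV[C]_n -> C) : (L2norm Omega f < +oo)%E ->
  fine (L2norm Omega f) ^+ 2 = \int[mu]_(t in D) normc (f (toCn t)) ^+ 2.
Proof.
move=> foo; rewrite /Rintegral -sqr_L2norm.
have : L2norm Omega f \is a fin_num by rewrite ge0_fin_numE// Lnorm_ge0.
have := Lnorm_ge0 mu 2%:E (EFin \o ((fun t => normc (f (toCn t))) \_ D)).
rewrite -/(L2norm Omega f); case: (L2norm Omega f) => //= r r0 _.
by rewrite powR_mulrn.
Qed.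

End square_integrable.

(** * Moments of the volume on Omega *)

(** A zero spreads in both directions, except to index 0, which is never the middle index of the
    inequality. *)
Lemma log_convex_vanish (R : realType) (M : nat -> R) : log_convex M ->
  (exists k, M k = 0) -> forall k, M k.+1 = 0.
Proof.
move=> lM [k Mk].
have up j : M (k + j)%N = 0.
  elim: j => [|j ih]; first by rewrite addn0.
  apply/eqP; rewrite -sqrf_eq0 eq_le sqr_ge0 andbT addnS.
  by rewrite (le_trans (lM _))// ih mul0r.
have down j i : (i + j = k)%N -> M i.+1 = 0.
  elim: j i => [|j ih] i ij.
    by rewrite -ij addn0 in up; have := up 1%N; rewrite addn1.
  apply/eqP; rewrite -sqrf_eq0 eq_le sqr_ge0 andbT.
  by rewrite (le_trans (lM _))// ih ?mulr0// addSnnS.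
move=> i; have [ik|ki] := leqP i k; first by apply: (down (k - i)%N); rewrite subnKC.
by rewrite -(subnKC (leqW (ltnW ki))) up.
Qed.

Section bergman_moments.
Context {R : realType} {n : nat}.
Local Notation C := R[i].
Local Notation normc := ComplexField.Normc.normc.
Local Notation Tn := (n.-tuple (measurableTypeR R * measurableTypeR R)).
Variable Omega : set 'rV[C]_n.
Hypothesis hD : condition_D Omega.
Let D := @toCn R n @^-1` Omega.
Let mu := @volume R n.

Let oOmega : open Omega. Proof. by case: hD => -[]. Qed.

Let mD : measurable D. Proof. exact: measurable_preimage_toCn. Qed.

Let monomial_lty alpha : (L2norm Omega (monomial alpha) < +oo)%E.
Proof. by case: hD => _ /(_ alpha)[]. Qed.

Lemma monomial_pow (j : 'I_n) k (z : 'rV[C]_n) :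
  monomial (fun i => if i == j then k else 0%N) z = z 0 j ^+ k.
Proof.
rewrite /monomial (bigD1 j)//= eqxx big1 ?mulr1// => i /negbTE ->.
by rewrite expr0.
Qed.

Definition moment (j : 'I_n) k : R :=
  fine (L2norm Omega (fun z => z 0%R j ^+ k)).

Let pow_lty j k : (L2norm Omega (fun z => z 0 j ^+ k)%R < +oo)%E.
Proof.
rewrite (_ : (fun z => _) = monomial (fun i => if i == j then k else 0%N))//.
by apply/funext => z; rewrite monomial_pow.
Qed.

Lemma monomial_integrable alpha : mu.-integrable D
  (EFin \o (fun t => normc (monomial alpha (toCn t)) ^+ 2)).
Proof. by apply: L2norm_integrable => //; exact: measurable_monomial. Qed.

Lemma pow_integrable j k : mu.-integrable D
  (EFin \o (fun t => normc ((toCn t) 0 j ^+ k) ^+ 2)).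
Proof.
apply: (L2norm_integrable (f := fun z => z 0 j ^+ k)) => //.
by apply: measurable_cfunX; exact: measurable_cfun_coord.
Qed.

Lemma sqr_moment j k :
  moment j k ^+ 2 = \int[mu]_(t in D) normc ((toCn t) 0 j ^+ k) ^+ 2.
Proof. exact: (sqr_fine_L2norm (f := fun z => z 0 j ^+ k)). Qed.

Lemma moment_ge0 j k : 0 <= moment j k.
Proof. by rewrite fine_ge0// Lnorm_ge0. Qed.

Lemma moment_log_convex j : log_convex (moment j).
Proof.
move=> k; rewrite -(@ler_pXn2r _ 2) ?nnegrE ?exprn_ge0 ?mulr_ge0 ?moment_ge0//.
rewrite [leRHS]exprMn !sqr_moment.
have e : (fun t : Tn => normc ((toCn t) 0 j ^+ k.+1) ^+ 2) =
    (fun t => normc ((toCn t) 0 j ^+ k) * normc ((toCn t) 0 j ^+ k.+2)).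
  apply/funext => t; rewrite expr2 -!ComplexField.Normc.normcM -!exprD.
  by rewrite addSnnS.
rewrite e; apply: Rintegral_cauchy_schwarz => //; [|exact: pow_integrable..].
by rewrite -e; exact: pow_integrable.
Qed.

(** If one moment vanished, all those of index at least 1 would. As a real power of 0 with nonzero
    exponent, even a negative one, is 0 here, the series of Condition D would then be 0 instead of
    [+oo]. *)
Lemma moment_gt0 j k : 0 < moment j k.
Proof.
rewrite lt0r moment_ge0 andbT; apply/eqP => Mk.
have M0 := log_convex_vanish (@moment_log_convex j) (ex_intro _ k Mk).
case: hD => _ _ /(_ j); rewrite /condition_Dj.
rewrite eseries0//; case => // i _ _.
by rewrite -/(moment j i.+1) M0 powR0// oppr_eq0 invr_eq0 pnatr_eq0.
Qed.

Lemma moment_diverges j : sum_unbounded (fun k => moment j k / moment j k.+1).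
Proof.
apply: carleman_ratio; first exact: moment_gt0.
by case: hD => _ _ /(_ j).
Qed.

End bergman_moments.

(** * Complex monomials and their behaviour under rotation *)

Section complex_moments.
Context {R : realType} {n : nat}.
Local Notation C := R[i].
Implicit Types (z : 'rV[C]_n) (alpha beta : 'I_n -> nat).

Definition zmono alpha beta z : C := monomial alpha z * conjc (monomial beta z).

Lemma monomial_incr alpha (j : 'I_n) z :
  monomial (fun i => alpha i + (i == j))%N z = z 0 j * monomial alpha z.
Proof.
rewrite -[in RHS](expr1 (z 0 j)) -monomial_pow /monomial -big_split/=.
by apply: eq_bigr => i _; rewrite addnC exprD; case: (i == j).
Qed.

Lemma mono_coord_poly (s : seq ('I_n * bool)) :
  exists l : seq (C * ('I_n -> nat) * ('I_n -> nat)), forall z,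
    (mono real_coord s z)%:C%C = \sum_(q <- l) q.1.1 * zmono q.1.2 q.2 z.
Proof.
elim: s => [|[j b] s [l hl]].
  exists [:: (1, fun=> 0%N, fun=> 0%N)] => z.
  rewrite big_seq1 /mono big_nil /zmono /monomial/= !big1//.
  by rewrite conjc1 !mulr1.
(* Multiplication of the expansion by [c1 * z_j + c2 * conjc z_j]; suitable [c1] and [c2] give the
   real and the imaginary part of [z_j]. *)
pose step (c1 c2 : C) :=
  [seq (c1 * q.1.1, (fun i => q.1.2 i + (i == j))%N, q.2) | q <- l] ++
  [seq (c2 * q.1.1, q.1.2, (fun i => q.2 i + (i == j))%N) | q <- l].
have stepE c1 c2 z : \sum_(q <- step c1 c2) q.1.1 * zmono q.1.2 q.2 z =
    (c1 * z 0 j + c2 * conjc (z 0 j)) * (mono real_coord s z)%:C%C.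
  rewrite hl big_cat/= !big_map/= mulrDl !mulr_sumr; congr (_ + _).
    by apply: eq_bigr => q _; rewrite /zmono monomial_incr; ring.
  apply: eq_bigr => q _; rewrite /zmono monomial_incr rmorphM/=; ring.
have -> : mono real_coord ((j, b) :: s) =
    fun z => real_coord (j, b) z * mono real_coord s z.
  by apply/funext => z; rewrite /mono big_cons.
case: b.
  exists (step 2^-1 2^-1) => z; rewrite stepE rmorphM/= /real_coord/= ReJ_add.
  by congr (_ * _); ring.
exists (step (- 2^-1 * 'i%C) (2^-1 * 'i%C)) => z.
by rewrite stepE rmorphM/= /real_coord/= ImJ_sub; congr (_ * _); ring.
Qed.

Lemma conjc_norm1 (x : C) : `|x| = 1 -> conjc x = x^-1.
Proof.
move=> x1; have x0 : x != 0 by rewrite -normr_eq0 x1 oner_eq0.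
apply: (mulfI x0); rewrite divff//.
have := add_Re2_Im2 x; rewrite x1 expr1n => <-.
case: x {x1 x0} => a b; apply/eqP; rewrite eq_complex /=.
by apply/andP; split; apply/eqP; ring.
Qed.

Lemma prod_expz (F : fieldType) (I : Type) (s : seq I) (f : I -> F) (m : int) :
  (\prod_(i <- s) f i) ^ m = \prod_(i <- s) f i ^ m.
Proof.
elim: s => [|i s ih]; first by rewrite !big_nil exp1rz.
by rewrite !big_cons expfzMl ih.
Qed.

Lemma expz_sum (F : fieldType) (I : Type) (s : seq I) (x : F) (f : I -> int) :
  x != 0 -> x ^ (\sum_(i <- s) f i) = \prod_(i <- s) x ^ f i.
Proof.
move=> x0; elim: s => [|i s ih]; first by rewrite !big_nil expr0z.
by rewrite !big_cons expfzDr// ih.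
Qed.

Definition weight r (A : 'M[int]_(n, r)) (lambda : 'rV[C]_r) (j : 'I_n) : C :=
  \prod_(k < r) lambda 0 k ^ A j k.

Lemma norm_weight r (A : 'M[int]_(n, r)) lambda j : torus lambda ->
  `|weight A lambda j| = 1.
Proof.
move=> tl; rewrite /weight normr_prod big1// => k _.
case: (A j k) => m; first by rewrite -exprnP normrX tl expr1n.
by rewrite NegzE -exprnN normfV normrX tl expr1n invr1.
Qed.

(** Each coordinate is multiplied by a weight of modulus 1, whose conjugate is its inverse; hence
    [beta] enters the character with a minus sign. *)
Lemma zmono_rho r (A : 'M[int]_(n, r)) lambda alpha beta z : torus lambda ->
  zmono alpha beta (rho A lambda z) = gchar A alpha beta lambda * zmono alpha beta z.
Proof.
move=> tl.
have monoE gamma : monomial gamma (rho A lambda z) =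
    \prod_(j < n) weight A lambda j ^+ gamma j * monomial gamma z.
  rewrite /monomial -big_split/=; apply: eq_bigr => j _.
  by rewrite mxE exprMn.
rewrite /zmono !monoE rmorphM/= mulrACA; congr (_ * _).
rewrite rmorph_prod/= -big_split/= /gchar.
have w0 j : weight A lambda j != 0.
  by rewrite -normr_eq0 norm_weight// oner_eq0.
have l0 k : lambda 0 k != 0 by rewrite -normr_eq0 tl oner_eq0.
under [RHS]eq_bigr do rewrite expz_sum//.
rewrite exchange_big/=; apply: eq_bigr => j _.
rewrite rmorphXn/= conjc_norm1 ?norm_weight//.
rewrite exprVn exprnN (exprnP (weight A lambda j)) -expfzDr//.
rewrite /weight prod_expz; apply: eq_bigr => k _.
by rewrite -exprz_exp.
Qed.

End complex_moments.

(** * Equality of the moments before and after rotation *)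

Section rotated_moments.
Context {R : realType} {n : nat}.
Local Notation C := R[i].
Local Notation normc := ComplexField.Normc.normc.
Local Notation Tn := (n.-tuple (measurableTypeR R * measurableTypeR R)).
Variable Omega : set 'rV[C]_n.
Hypothesis hD : condition_D Omega.
Let D := @toCn R n @^-1` Omega.
Let mu := @volume R n.

Let mD : measurable D.
Proof. by apply: measurable_preimage_toCn; case: hD => -[]. Qed.

Lemma normcX (x : C) k : normc (x ^+ k) = normc x ^+ k.
Proof.
elim: k => [|k ih]; first by rewrite !expr0 ComplexField.Normc.normc1.
by rewrite !exprS ComplexField.Normc.normcM ih.
Qed.

Lemma Re_zmono_integrable (om : C) alpha beta : mu.-integrable D
  (EFin \o (fun t => complex.Re (om * zmono alpha beta (toCn t)))).
Proof.
have i1 := monomial_integrable hD alpha; have i2 := monomial_integrable hD beta.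
apply: (le_integrableR mD (g := fun t => normc om *
  (normc (monomial alpha (toCn t)) ^+ 2 + normc (monomial beta (toCn t)) ^+ 2))).
- have [] // : measurable_cfun D
      (fun t : Tn => om * zmono alpha beta (toCn t)).
  apply: measurable_cfunM; first exact: measurable_cfun_cst.
  apply: measurable_cfunM; first exact: measurable_monomial.
  by apply: measurable_cfun_conj; exact: measurable_monomial.
- move=> t _; rewrite (le_trans (ler_norm_Re _))// /zmono.
  rewrite !ComplexField.Normc.normcM ler_wpM2l ?normc_ge0//.
  have -> : normc (conjc (monomial beta (toCn t))) = normc (monomial beta (toCn t)).
    by case: (monomial _ _) => a b /=; rewrite sqrrN.
  have := normc_ge0 (monomial alpha (toCn t)).
  have := normc_ge0 (monomial beta (toCn t)).
  by move: (normc _) (normc _) => x y x0 y0; nra.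
- by apply: integrableZR => //; exact: integrableDR.
Qed.

Lemma Rintegral_zmono_eq0 (om : C) alpha beta :
  inner Omega (monomial alpha) (monomial beta) = 0 ->
  \int[mu]_(t in D) complex.Re (om * zmono alpha beta (toCn t)) = 0.
Proof.
move=> /eqP; rewrite /inner /integralCn eq_complex /= => /andP[/eqP re0 /eqP im0].
have iR := Re_zmono_integrable 1 alpha beta.
(* The factor [- 'i] turns the real part into the imaginary part. *)
have iI := Re_zmono_integrable (- 'i%C) alpha beta.
have eR : (fun t : Tn => complex.Re (1 * zmono alpha beta (toCn t))) =
    (fun t => complex.Re (zmono alpha beta (toCn t))).
  by apply/funext => t; rewrite mul1r.
have eI : (fun t : Tn => complex.Re (- 'i%C * zmono alpha beta (toCn t))) =
    (fun t => complex.Im (zmono alpha beta (toCn t))).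
  by apply/funext => t; rewrite Re_mulc /=; ring.
rewrite eR in iR; rewrite eI in iI.
under eq_Rintegral do rewrite Re_mulc.
rewrite RintegralB//; [|exact: integrableZR..].
by rewrite !RintegralZl// re0 im0 !mulr0 subrr.
Qed.

Variables (r : nat) (A : 'M[int]_(n, r)).
Hypothesis hg : forall alpha beta : 'I_n -> nat,
  inner Omega (monomial alpha) (monomial beta) <> 0 ->
  forall lambda : 'rV[C]_r, torus lambda -> gchar A alpha beta lambda = 1.
Variable lambda : 'rV[C]_r.
Hypothesis tl : torus lambda.

Lemma Re_zmono_rho_integrable (om : C) alpha beta : mu.-integrable D
  (EFin \o (fun t => complex.Re (om * zmono alpha beta (rho A lambda (toCn t))))).
Proof.
under eq_fun do rewrite zmono_rho// mulrA.
exact: Re_zmono_integrable.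
Qed.

(** Either the inner product vanishes, and both sides are 0 whatever the factor in front, or the
    character is 1. *)
Lemma Rintegral_zmono_rho (om : C) alpha beta :
  \int[mu]_(t in D) complex.Re (om * zmono alpha beta (rho A lambda (toCn t))) =
  \int[mu]_(t in D) complex.Re (om * zmono alpha beta (toCn t)).
Proof.
under eq_Rintegral do rewrite zmono_rho// mulrA.
have [i0|/eqP i0] := eqVneq (inner Omega (monomial alpha) (monomial beta)) 0.
  by rewrite !Rintegral_zmono_eq0.
by rewrite hg// mulr1.
Qed.

Let X (i : 'I_n * bool) (t : Tn) := real_coord i (toCn t).
Let Y (i : 'I_n * bool) (t : Tn) := real_coord i (rho A lambda (toCn t)).

Lemma mono_coordE s : exists l : seq (C * ('I_n -> nat) * ('I_n -> nat)),
  forall z, mono real_coord s z =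
    \sum_(q <- l) 1 * complex.Re (q.1.1 * zmono q.1.2 q.2 z).
Proof.
have [l hl] := @mono_coord_poly R n s; exists l => z.
transitivity (complex.Re (mono real_coord s z)%:C%C) => //; rewrite hl.
elim: l {hl} => [|q l ih]; first by rewrite !big_nil.
by rewrite !big_cons -ih mul1r; case: (_ * _); case: (\sum_(_ <- _) _).
Qed.

Lemma coord_mono_integrable s : mu.-integrable D (EFin \o mono X s).
Proof.
have [l hl] := mono_coordE s.
have -> : mono X s = (fun t => mono real_coord s (toCn t)) by [].
under eq_fun do rewrite hl.
by apply: integrable_sumR => // q; exact: Re_zmono_integrable.
Qed.

Lemma rotated_mono_integrable s : mu.-integrable D (EFin \o mono Y s).
Proof.
have [l hl] := mono_coordE s.
have -> : mono Y s = (fun t => mono real_coord s (rho A lambda (toCn t))) by [].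
under eq_fun do rewrite hl.
by apply: integrable_sumR => // q; exact: Re_zmono_rho_integrable.
Qed.

Lemma Rintegral_rotated_mono s :
  \int[mu]_(t in D) mono X s t = \int[mu]_(t in D) mono Y s t.
Proof.
have [l hl] := mono_coordE s.
transitivity (\int[mu]_(t in D) mono real_coord s (toCn t)) => //.
transitivity (\int[mu]_(t in D) mono real_coord s (rho A lambda (toCn t))) => //.
under eq_Rintegral do rewrite hl.
under [RHS]eq_Rintegral do rewrite hl.
rewrite Rintegral_sum//; last by move=> q; exact: Re_zmono_integrable.
rewrite Rintegral_sum//; last by move=> q; exact: Re_zmono_rho_integrable.
by apply: eq_bigr => q _; rewrite Rintegral_zmono_rho.
Qed.

(** Stated for any [W] dominated by [|z_j|], so as to cover the original and the rotated coordinates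
    with one sequence. *)
Lemma Rintegral_pow_le_moment (W : Tn -> R) (j : 'I_n) k :
  measurable_fun D W -> (forall t, `|W t| <= normc (toCn t 0 j)) ->
  \int[mu]_(t in D) (W t ^+ k) ^+ 2 <= moment Omega j k ^+ 2.
Proof.
move=> mW Wz; rewrite sqr_moment//.
have le t : (W t ^+ k) ^+ 2 <= normc (toCn t 0 j ^+ k) ^+ 2.
  rewrite normcX -[leLHS]real_normK ?num_real// normrX.
  by rewrite !lerXn2r ?nnegrE ?exprn_ge0 ?normc_ge0.
apply: le_Rintegral => //; last exact: pow_integrable.
apply: le_integrableR (pow_integrable hD j k) => //.
  by apply: measurable_funX; exact: measurable_funX.
by move=> t _; rewrite ger0_norm ?sqr_ge0.
Qed.

Lemma normc_weight j : normc (weight A lambda j) = 1.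
Proof. by have := norm_weight A j tl; rewrite norm_normc => -[]. Qed.

Lemma norm_real_coord_le (i : 'I_n * bool) (z : 'rV[C]_n) :
  `|real_coord i z| <= normc (z 0 i.1).
Proof. by rewrite /real_coord; case: ifP => _; rewrite ?ler_norm_Re ?ler_norm_Im. Qed.

Lemma gauss_rotated_moments s a sg :
  \int[mu]_(t in D) gauss_prod X s a sg t =
  \int[mu]_(t in D) gauss_prod Y s a sg t.
Proof.
apply: (gauss_moments mD coord_mono_integrable rotated_mono_integrable
  Rintegral_rotated_mono (M := fun i => moment Omega i.1)).
- by move=> i k; exact: moment_gt0.
- by move=> i; exact: moment_log_convex.
- by move=> i; exact: moment_diverges.
- move=> i k; apply: Rintegral_pow_le_moment.
    exact: (coordinate_measurable i coord_mono_integrable).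
  by move=> t; exact: norm_real_coord_le.
- move=> i k; apply: Rintegral_pow_le_moment.
    exact: (coordinate_measurable i rotated_mono_integrable).
  move=> t; rewrite (le_trans (norm_real_coord_le _ _))// mxE.
  by rewrite ComplexField.Normc.normcM normc_weight mul1r.
Qed.

End rotated_moments.
(** * Invariance of the interior of the closure *)

(** By continuity [f] maps the closure into itself. Near [f z], the preimage of the closure under
    [g] is a neighbourhood, and each of its points [w = f (g w)] is the image of a point of the
    closure. *)
Lemma homeo_interior_closure_subset (T : topologicalType) (f g : T -> T)
    (U : set T) :
  continuous f -> continuous g -> cancel f g -> cancel g f ->
  f @` U `<=` closure U -> f @` (closure U)^° `<=` (closure U)^°.
Proof.
move=> cf cg fK gK fU _ [z iz <-].
have cl w : closure U w -> closure U (f w).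
  move=> cw; rewrite ((closure_id _).1 (@closed_closure _ U)).
  apply: (closureS fU) => B /cf nB; have [p [Up Bp]] := cw _ nB.
  by exists (f p); split => //; exists p.
have : nbhs (f z) (g @^-1` closure U) by apply: cg; rewrite fK.
by apply: filterS => w /= /cl; rewrite gK.
Qed.

Section closure_invariance.
Context {R : realType} {n : nat}.
Local Notation C := R[i].
Local Notation normc := ComplexField.Normc.normc.
Local Notation Tn := (n.-tuple (measurableTypeR R * measurableTypeR R)).
Local Notation I := ('I_n * bool)%type.
Variable Omega : set 'rV[C]_n.
Variables (r : nat) (A : 'M[int]_(n, r)).

(** A rotation mixes the real and imaginary parts of a coordinate but keeps its modulus, which is at
    most their sum; hence the factor 2. *)
Lemma rho_real_coord_lt lambda (z w : 'rV[C]_n) (dl : R) : torus lambda ->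
  (forall i, `|real_coord i w - real_coord i z| < dl) ->
  forall i, `|real_coord i (rho A lambda w) - real_coord i (rho A lambda z)| < 2 * dl.
Proof.
move=> tl wz [j b].
have e : rho A lambda w 0 j - rho A lambda z 0 j =
      weight A lambda j * (w 0 j - z 0 j).
  by rewrite !mxE mulrBr.
have le : normc (rho A lambda w 0 j - rho A lambda z 0 j) < 2 * dl.
  rewrite e ComplexField.Normc.normcM normc_weight// mul1r.
  apply: le_lt_trans (ler_normc_ReDIm _) _; rewrite Re_subc Im_subc.
  have := wz (j, true); have := wz (j, false); rewrite /real_coord/=.
  by move: `|_| `|_| => x y; lra.
apply: le_lt_trans le; rewrite /real_coord/=; case: b.
  by rewrite -Re_subc ler_norm_Re.
by rewrite -Im_subc ler_norm_Im.
Qed.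

Lemma rho_continuous lambda : torus lambda ->
  continuous (rho A lambda : 'rV[C]_n -> 'rV[C]_n).
Proof.
move=> tl z U /nbhs_box[e e0 eU].
have := box_nbhs z (divr_gt0 e0 (ltr0n _ 2)); apply: filterS => w /= wz.
apply: eU => i; have := rho_real_coord_lt tl wz i.
by rewrite mulrC divfK.
Qed.

Hypothesis hD : condition_D Omega.
Hypothesis hg : forall alpha beta : 'I_n -> nat,
  inner Omega (monomial alpha) (monomial beta) <> 0 ->
  forall lambda : 'rV[C]_r, torus lambda -> gchar A alpha beta lambda = 1.

Let D := @toCn R n @^-1` Omega.
Let mu := @volume R n.

Let oOmega : open Omega. Proof. by case: hD => -[]. Qed.

Let mD : measurable D. Proof. exact: measurable_preimage_toCn. Qed.

(** If the box of radius [e] at [a] misses [Omega], the Gaussian along [X] is at most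
    [exp (- (sg e)^2 / 2)], while along [Y] it is at least [exp (- (sg e)^2 / 4)] on a box of
    positive volume around [z0]. Equal integrals forbid this for large [sg]. *)
Lemma rho_subset_closure lambda : torus lambda ->
  rho A lambda @` Omega `<=` closure Omega.
Proof.
move=> tl _ [z0 Oz0 <-]; set a := rho A lambda z0.
apply: contrapT => /existsNP[B /not_implyP[/nbhs_box[e e0 eB] OB]].
pose X (i : I) (t : Tn) := real_coord i (toCn t).
pose Y (i : I) (t : Tn) := real_coord i (rho A lambda (toCn t)).
pose G (Z : I -> Tn -> R) := gauss_prod Z (index_enum I) (real_coord ^~ a).
have far t : D t -> exists i, e <= `|X i t - real_coord i a|.
  move=> Dt; apply: contrapT => /forallNP h; apply: OB; exists (toCn t).
  by split => //; apply: eB => i; rewrite ltNge; apply/negP/h.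
have [e' e'0 eO] := nbhs_box (open_nbhs_nbhs (conj oOmega Oz0)).
pose N : R := #|{: I}|%:R.
have N0 : 0 <= N by [].
(* The first bound keeps the box inside [Omega]; the second keeps the sum of the [N] squared
   deviations, each below [(2 * dl) ^+ 2], under [e ^+ 2 / 2]. *)
pose dl := Num.min e' (e / (4 * (N + 1))).
have dl0 : 0 < dl by rewrite lt_min e'0 divr_gt0// mulr_gt0// ltr_wpDl.
have Ndl : N * (2 * dl) ^+ 2 <= e ^+ 2 / 2.
  have N1 : 0 < N + 1 by rewrite ltr_wpDl.
  have : dl ^+ 2 <= (e / (4 * (N + 1))) ^+ 2.
    rewrite lerXn2r ?nnegrE ?(ltW dl0) ?divr_ge0 ?(ltW e0)//.
      by rewrite mulr_ge0// ltW.
    by rewrite ge_min lexx orbT.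
  move=> /(ler_wpM2l (mulr_ge0 N0 (ler0n _ 4))).
  rewrite (_ : N * (2 * dl) ^+ 2 = N * 4 * dl ^+ 2); last by ring.
  move=> /le_trans; apply.
  have -> : N * 4 * (e / (4 * (N + 1))) ^+ 2 =
      (e ^+ 2 / 2) * (N / (2 * (N + 1) ^+ 2)).
    by field; rewrite gt_eqF.
  rewrite ler_piMr ?divr_ge0 ?sqr_ge0// ler_pdivrMr ?mulr_gt0 ?exprn_gt0// mul1r.
  nra.
pose box := [set t : Tn | forall i, `|real_coord i (toCn t) - real_coord i z0| < dl].
have boxD : box `<=` D.
  by move=> t bt; apply: eO => i; rewrite (lt_le_trans (bt i))// ge_min lexx.
have mbox : measurable box by exact: measurable_box.
(* The empty monomial is the constant 1, so [Omega] has finite volume. *)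
have one_int : mu.-integrable D (EFin \o (fun=> 1%R)).
  have := coord_mono_integrable hD [::].
  congr (_.-integrable _ _); apply/funext => t.
  by rewrite /= /mono big_nil.
have cst_int c : mu.-integrable D (EFin \o (fun=> c)).
  have := integrableZR mD c one_int; congr (_.-integrable _ _).
  by apply/funext => t /=; rewrite mulr1.
have Doo : (mu D < +oo)%E.
  move/integrableP: one_int => [_].
  by under eq_integral do rewrite /= normr1; rewrite integral_cst// mul1e.
have boxoo : (mu box < +oo)%E.
  by apply: le_lt_trans Doo; apply: le_measure => //; rewrite inE.
pose V := fine (mu D); pose v := fine (mu box).
have v0 : 0 < v.
  by rewrite fine_gt0// boxoo andbT; exact: volume_box_gt0.
have mX i : measurable_fun D (X i).
  by apply: measurable_funTS; exact: measurable_coord.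
have mY i : measurable_fun D (Y i).
  exact: (coordinate_measurable i (rotated_mono_integrable hD A tl)).
have G01 Z sg t : 0 <= G Z sg t <= 1.
  rewrite /G /gauss_prod prodr_ge0/=; last by move=> i _; exact: expR_ge0.
  apply: prodr_ile1 => i _; rewrite expR_ge0/=.
  have := gauss_factor_le1 (sg * (Z i t - real_coord i a)).
  by rewrite ger0_norm ?expR_ge0.
have intG Z sg : (forall i, measurable_fun D (Z i)) ->
    mu.-integrable D (EFin \o G Z sg).
  move=> mZ; apply: le_integrableR one_int => //; first exact: gauss_prod_measurable.
  by move=> t _; have /andP[g0 g1] := G01 Z sg t; rewrite ger0_norm.
(* One factor is small because some coordinate is at distance at least [e]; the others are at most
   1. *)
have upper sg : \int[mu]_(t in D) G X sg t <= expR (- ((sg * e) ^+ 2 / 2)) * V.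
  rewrite -Rintegral_cst//; apply: le_Rintegral => //; first exact: intG.
  move=> t Dt; have [i ei] := far t Dt.
  rewrite /G /gauss_prod (bigD1 i)//= -[leRHS]mulr1 ler_pM//.
  - exact: prodr_ge0.
  - rewrite ler_expR lerN2 ler_pM2r// !exprMn ler_wpM2l ?sqr_ge0//.
    by rewrite -[leRHS]real_normK ?num_real// lerXn2r ?nnegrE// ltW.
  - apply: prodr_ile1 => k _; rewrite expR_ge0/=.
    have := gauss_factor_le1 (sg * (X k t - real_coord k a)).
    by rewrite ger0_norm ?expR_ge0.
have lower sg : expR (- (sg ^+ 2 * (e ^+ 2 / 2) / 2)) * v <=
    \int[mu]_(t in D) G Y sg t.
  set c := expR _.
  have ind_int : mu.-integrable D (EFin \o (\1_box : Tn -> R)).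
    apply: le_integrableR one_int => //.
    by move=> t _; rewrite indicE; case: (_ \in _); rewrite ?normr1 ?normr0.
  have -> : c * v = \int[mu]_(t in D) (c * \1_box t).
    rewrite RintegralZl//; congr (_ * _).
    by rewrite /Rintegral integral_indic// setIidl.
  apply: le_Rintegral => //; [exact: integrableZR|exact: intG|move=> t Dt].
  rewrite indicE; have [bt|_] := boolP (t \in box); last first.
    by rewrite mulr0; have /andP[] := G01 Y sg t.
  rewrite mulr1 /G /gauss_prod.
  apply: (@le_trans _ _ (\prod_(i : I) expR (- ((sg * (2 * dl)) ^+ 2 / 2)))).
    rewrite prodr_const -expRM_natl -/N ler_expR mulrN lerN2.
    rewrite (_ : N * _ = sg ^+ 2 * (N * (2 * dl) ^+ 2) / 2); last by ring.
    by rewrite ler_pM2r// ler_wpM2l// sqr_ge0.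
  apply: ler_prod => i _; rewrite expR_ge0/= ler_expR lerN2 ler_pM2r//.
  rewrite !exprMn ler_wpM2l ?sqr_ge0// -exprMn.
  rewrite -[leLHS]real_normK ?num_real// lerXn2r ?nnegrE// ?mulr_ge0 ?(ltW dl0)//.
  by rewrite ltW// rho_real_coord_lt//; move: bt; rewrite inE.
have main sg : v * (1 + (sg * e) ^+ 2 / 4) <= V.
  have := upper sg; rewrite (gauss_rotated_moments hD hg tl).
  move=> /(le_trans (lower sg)).
  have -> : - ((sg * e) ^+ 2 / 2) =
      - (sg ^+ 2 * (e ^+ 2 / 2) / 2) + - ((sg * e) ^+ 2 / 4).
    by field.
  rewrite expRD -[leRHS]mulrA ler_pM2l ?expR_gt0//.
  rewrite expRN mulrC ler_pdivlMr ?expR_gt0//.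
  apply: le_trans; rewrite ler_pM2l//; exact: expR_ge1Dx.
(* For this [sg] the inequality reads [v + V <= V], against [0 < v]. *)
have := main (2 / e * Num.sqrt (V / v)).
have Vv : 0 <= V / v by rewrite divr_ge0 ?fine_ge0// ltW.
rewrite (_ : _ / 4 = Num.sqrt (V / v) ^+ 2); last by field; rewrite gt_eqF.
by rewrite sqr_sqrtr// mulrDr mulr1 mulrC divfK ?gt_eqF// gerDr leNgt v0.
Qed.

End closure_invariance.

Theorem theorem3 (R : realType) (n : nat) (Omega : set 'rV[R[i]]_n)
  (hD : condition_D Omega)
  (r : nat) (hr : (1 <= r <= n)%N) (A : 'M[int]_(n, r))
  (hg : forall alpha beta : 'I_n -> nat,
      inner Omega (monomial alpha) (monomial beta) <> 0 ->
      forall lambda : 'rV[R[i]]_r, torus lambda ->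
        gchar A alpha beta lambda = 1) :
  rho_invariant A (interior (closure Omega)).
Proof.
move=> lambda tl.
(* The inverse rotation also comes from the torus, so [rho_subset_closure] applies to it too and
   yields the reverse inclusion. *)
pose lambda' : 'rV[R[i]]_r := \row_k (lambda 0 k)^-1.
have tl' : torus lambda' by move=> k; rewrite mxE normfV tl invr1.
have weightV j : weight A lambda' j = (weight A lambda j)^-1.
  rewrite /weight -prodfV; apply: eq_bigr => k _.
  by rewrite mxE exprz_inv invr_expz.
have w0 j : weight A lambda j != 0.
  by rewrite -normr_eq0 norm_weight// oner_eq0.
have rhoK : cancel (rho A lambda) (rho A lambda' : 'rV[R[i]]_n -> _).
  move=> z; apply/rowP => j; rewrite !mxE -!/(weight _ _ j) weightV mulKf//.
have rhoVK : cancel (rho A lambda') (rho A lambda : 'rV[R[i]]_n -> _).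
  move=> z; apply/rowP => j; rewrite !mxE -!/(weight _ _ j) weightV mulVKf//.
apply/seteqP; split.
  exact: (homeo_interior_closure_subset (rho_continuous tl)
    (rho_continuous tl') rhoK rhoVK
    (rho_subset_closure hD hg tl)).
move=> z iz; exists (rho A lambda' z); last exact: rhoVK.
apply: (homeo_interior_closure_subset (rho_continuous tl')
    (rho_continuous tl) rhoVK rhoK
    (rho_subset_closure hD hg tl')).
by exists z.
Qed.
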